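(* For every $n\ge1$, $$\mathrm{SH}_n(x)=\frac{1}{n+1}\sum_{\lambda} 2^{\ell(\lambda)}\,P_\lambda(1^{n+1})\,P_\lambda(x),$$ the sum over all partitions $\lambda$ of $n$ into distinct parts, where $\ell(\lambda)$ is the number of parts and $P_\lambda(1^{n+1})$ denotes $P_\lambda$ evaluated at $x_1=\cdots=x_{n+1}=1$, $x_i=0$ for $i>n+1$.
   Context: Work in the ring $\Lambda_{\mathbb Q}$ of symmetric functions with rational coefficients in variables $x=(x_1,x_2,\dots)$; $p_k$ denotes the power sum. For $f\in\Lambda_{\mathbb Q}$, its shiftification $f(x/x)$ is obtained by writing $f$ as a polynomial in the power sums and substituting $p_{2i+1}\mapsto 2p_{2i+1}$ and $p_{2i}\mapsto 0$ for all $i\ge1$. A parking function of length $n$ is a sequence $(a_1,\dots,a_n)$ of positive integers whose weakly increasing rearrangement $b_1\le\cdots\le b_n$ satisfies $b_i\le i$ for all $i$. The symmetric group $S_n$ acts on the set of parking functions of length $n$ by permuting coordinates; $\mathrm{PF}_n$ denotes the Frobenius characteristic of this permutation representation ($\mathrm{PF}_0=1$). Define $\mathrm{SH}_n(x)=\mathrm{PF}_n(x/x)$. For a partition $\lambda$ with distinct parts, $P_\lambda$ denotes Schur's $P$-function (as in Macdonald, Ch. III.8); in particular $1+2\sum_{n\ge1}P_n(x)t^n=\prod_i\frac{1+x_it}{1-x_it}$. *)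

(* Defs.v *)
From HB Require Import structures.
From mathcomp Require Import all_boot all_order all_algebra all_fingroup.
From mathcomp Require Export mpoly.
Set Implicit Arguments. Unset Strict Implicit. Unset Printing Implicit Defensive.
Import Order.TTheory GRing.Theory Num.Theory.
Local Open Scope ring_scope.

(* Symmetric functions.  An identity in Lambda_Q between homogeneous   *)
(* symmetric functions is stated as the corresponding identity in      *)
(* {mpoly rat[N]} (specialisation x_{N+1} = x_{N+2} = ... = 0) for      *)
(* EVERY number N of variables; this is equivalent to the identity in  *)
(* Lambda_Q (the projection Lambda^n -> Lambda^n_N is injective for    *)
(* N >= n, and a ring morphism for all N).                             *)

Definition psum (N k : nat) : {mpoly rat[N]} := \sum_(i < N) 'X_i ^+ k.

(* Polynomials in the power sums p_0,...,p_m ('X_k stands for p_k; p_0 is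
   never used).  Evaluation of such a polynomial as a symmetric function
   in N variables: *)
Definition peval (m N : nat) (f : {mpoly rat[m.+1]}) : {mpoly rat[N]} :=
  f \mPo [tuple psum N k | k < m.+1].

Definition shiftp (m : nat) (f : {mpoly rat[m.+1]}) : {mpoly rat[m.+1]} :=
  f \mPo [tuple (if odd k then 2%:R * 'X_k else 0 : {mpoly rat[m.+1]}) | k < m.+1].

(* Parking functions.  A parking function of length n takes values in  *)
(* {1..n} (b_i <= i <= n), so we represent it as a map 'I_n -> 'I_n.+1  *)
(* (value v meaning the positive integer v) satisfying positivity and  *)
(* the parking condition.                                              *)
Definition is_parking (n : nat) (a : {ffun 'I_n -> 'I_n.+1}) : bool :=
  [forall i, (0 < val (a i))%N] &&
  (let b := sort leq [seq val (a i) | i <- enum 'I_n] in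
   [forall i : 'I_n, (nth 0 b i <= i.+1)%N]).

Definition pf_act (n : nat) (s : 'S_n) (a : {ffun 'I_n -> 'I_n.+1})
  : {ffun 'I_n -> 'I_n.+1} := [ffun i => a (s^-1%g i)].

(* character of the permutation representation: number of fixed points *)
Definition pf_char (n : nat) (s : 'S_n) : nat :=
  #|[set a : {ffun 'I_n -> 'I_n.+1} | is_parking a && (pf_act s a == a)]|.

Definition p_cycle_type (n : nat) (s : 'S_n) : {mpoly rat[n.+1]} :=
  \prod_(c in porbits s) 'X_(inord #|c|).

(* Frobenius characteristic ch(chi) = 1/n! sum_s chi(s) p_{rho(s)} of the
   permutation representation on parking functions, in the power sums *)
Definition PFp (n : nat) : {mpoly rat[n.+1]} :=
  (n`!%:R)^-1 *: \sum_(s : 'S_n) (pf_char s)%:R *: p_cycle_type s.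

(* PF_n and SH_n = PF_n(x/x) in N variables *)
Definition PF (n N : nat) : {mpoly rat[N]} := peval N (PFp n).
Definition SH (n N : nat) : {mpoly rat[N]} := peval N (shiftp (PFp n)).

(* Schur P-functions via marked shifted tableaux (Macdonald III (8.16')):*)
(* P_la = sum_T x^T over marked shifted tableaux T of shape S(la) with  *)
(* unprimed diagonal.  Letters 1'<1<2'<2<... are encoded (k, primed)    *)
(* with k : 'I_N (letter k.+1), ranked 2k + (unprimed).                 *)
(* la is a strictly decreasing sequence of positive parts.              *)
Definition mletter (N : nat) := ('I_N * bool)%type.
Definition mrank (N : nat) (a : mletter N) : nat := (2 * val a.1 + ~~ a.2)%N.

Definition in_shifted (la : seq nat) (i j : nat) : bool :=
  ((i < size la) && (i <= j < i + nth 0 la i))%N.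

Definition cellbox (la : seq nat) := ('I_(size la) * 'I_(size la + sumn la))%type.

Definition is_cell (la : seq nat) (c : cellbox la) : bool :=
  in_shifted la (val c.1) (val c.2).

Definition is_mst (N : nat) (la : seq nat)
  (T : {ffun cellbox la -> option (mletter N)}) : bool :=
  [forall c, (T c != None) == is_cell c] &&
  [forall c1, forall c2,
    match T c1, T c2 with
    | Some a1, Some a2 =>
      [&& ((c1.1 == c2.1) && (val c1.2 < val c2.2)%N) ==> (mrank a1 <= mrank a2)%N,
          ((c1.2 == c2.2) && (val c1.1 < val c2.1)%N) ==> (mrank a1 <= mrank a2)%N,
          ((c1.1 == c2.1) && (c1 != c2) && (a1 == a2)) ==> ~~ a1.2 &
          ((c1.2 == c2.2) && (c1 != c2) && (a1 == a2)) ==> a1.2]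
    | _, _ => true
    end] &&
  [forall c, (val c.1 == val c.2) ==>
      (if T c is Some a then ~~ a.2 else true)].

Definition SchurP (N : nat) (la : seq nat) : {mpoly rat[N]} :=
  \sum_(T : {ffun cellbox la -> option (mletter N)} | is_mst T)
    \prod_(c : cellbox la) (if T c is Some a then 'X_(a.1) else 1).

(* Partitions of n into distinct parts <-> sets A of distinct positive  *)
(* parts with sum n; la(A) is A sorted decreasingly, l(la) = #|A|.      *)
Definition strict_partition_set (n : nat) (A : {set 'I_n.+1}) : bool :=
  (ord0 \notin A) && (\sum_(i in A) val i == n)%N.

Definition part_of_set (n : nat) (A : {set 'I_n.+1}) : seq nat :=
  sort geq [seq val i | i <- enum A].

(* Main.v *)
Require Import Defs.
From mathcomp Require Import all_boot all_order all_algebra all_fingroup.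
From mathcomp Require Import mpoly.
From mathcomp Require Import ring zify.
Set Implicit Arguments. Unset Strict Implicit. Unset Printing Implicit Defensive.
Import Order.TTheory GRing.Theory Num.Theory.
Local Open Scope ring_scope.

(** By Pollak's circle argument every function {1..n} -> Z/(n+1) has exactly one rotation that is a
    parking function, so a permutation s fixes (n+1)^(cyc s - 1) parking functions.  Hence
    (n+1) SH_n is the cycle-index average of prod_c z_|c| over S_n with z_k = 2(n+1) p_k for k odd
    and z_k = 0 for k even.  By the recurrence n h_n = sum_j z_j h_(n-j) this average is the
    coefficient of t^n in prod_i ((1 + x_i t)/(1 - x_i t))^(n+1).

    It remains to prove the Cauchy identity for Schur's P-functions at y = 1^(n+1).  Removing the
    largest letter of a marked shifted tableau gives a branching rule over interlacing strict
    partitions.  Reading strict partitions as 0/1 sequences from the largest possible part down,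
    the branching weight is the partition function of one row of a free-fermionic six-vertex model,
    and a Yang-Baxter relation exchanges a row adding a strip with a row removing one, up to the
    factor (1 + xy)/(1 - xy).  Parts are bounded by n, which only affects terms of degree
    greater than n in t. *)

(** * Parking functions and rotations *)


Lemma sorted_nth_leqP (s : seq nat) : sorted leq s ->
  (forall i, (i < size s)%N -> (nth 0 s i <= i.+1)%N) <->
  (forall k, (k <= size s)%N -> (k <= count (fun v => v <= k)%N s)%N).
Proof.
move=> srt; split=> [h k ks|h i hi].
  rewrite -[s in count _ s](cat_take_drop k) count_cat.
  have /eqP -> : count (fun v => v <= k)%N (take k s) == size (take k s).
    rewrite -all_count; apply/(all_nthP 0) => i.
    rewrite size_takel // => ik; rewrite nth_take //.
    exact: leq_trans (h i (leq_trans ik ks)) ik.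
  by rewrite size_takel // leq_addr.
rewrite leqNgt; apply/negP => lt_i.
have := h i.+1 hi; rewrite -[s in count _ s](cat_take_drop i) count_cat.
have -> : count (fun v => v <= i.+1)%N (drop i s) = 0%N.
  apply/eqP; rewrite -leqn0 leqNgt -has_count; apply/hasPn => v /(nthP 0)[j].
  rewrite size_drop nth_drop => js <-; rewrite -ltnNge.
  apply: (leq_trans lt_i); apply: (sorted_leq_nth leq_trans leqnn) => //;
    rewrite ?unfold_in /= ?leq_addr //; by move: js; rewrite ltn_subRL.
rewrite addn0 => h1; have := leq_trans h1 (count_size _ _).
by rewrite size_takel ?ltnn // ltnW.
Qed.

Section Pollak.
Variable n : nat.
Implicit Types (a : {ffun 'I_n -> 'I_n.+1}) (r : 'I_n.+1).

Definition mult a (v : nat) : nat := #|[set i | val (a i) == v %% n.+1]|%N.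

Definition cumul a (k : nat) : nat := (\sum_(1 <= v < k.+1) mult a v)%N.

Lemma is_parkingP a :
  reflect (forall k, (k <= n)%N -> (k <= cumul a k)%N) (is_parking a).
Proof.
set b := sort leq [seq val (a i) | i <- enum 'I_n].
have sb : size b = n by rewrite size_sort size_map size_enum_ord.
have cnt k : (k <= n)%N ->
    (cumul a k + #|[set i | val (a i) == 0]|)%N = count (fun v => v <= k)%N b.
  move=> kn; rewrite (seq.permP (permEl (perm_sort _ _))) count_map.
  have -> : count (preim (fun i => val (a i)) (fun v => v <= k)%N) (enum 'I_n)
    = #|[set i | (val (a i) <= k)%N]|.
    by rewrite cardE [X in size X]/enum_mem size_filter -enumT; apply: eq_count => i; rewrite /= inE.
  elim: k kn => [|k IH] kn.
    rewrite /cumul big_geq // add0n; apply: eq_card => i.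
    by rewrite !inE leqn0.
  rewrite /cumul big_nat_recr //= addnAC -/(cumul a k) IH; last exact: ltnW.
  rewrite /mult modn_small // -cardsUI.
  rewrite [X in (_ + X)%N](_ : _ = 0%N) ?addn0.
    by apply: eq_card => i; rewrite !inE /=; lia.
  by apply/eqP; rewrite cards_eq0; apply/eqP/setP => i; rewrite !inE /=; lia.
have srt : sorted leq b by apply: sort_sorted; exact: leq_total.
have [h1 h2] := sorted_nth_leqP srt; rewrite sb in h1 h2.
rewrite /is_parking -/b; apply: (iffP andP) => [[/forallP pos /forallP h] k kn|h].
  have := h1 (fun i hi => h (Ordinal hi)) k kn; rewrite -cnt //.
  rewrite (_ : #|_| = 0%N) ?addn0 //; apply/eqP; rewrite cards_eq0.
  by apply/eqP/setP => i; rewrite !inE; have := pos i; lia.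
have z0 : #|[set i | val (a i) == 0]| = 0%N.
  have := count_size (fun v => v <= n)%N b; rewrite sb -cnt // => hs.
  have := leq_add (h n (leqnn n)) (leqnn #|[set i | val (a i) == 0]|).
  by move=> /leq_trans /(_ hs); move: #|_| => u; lia.
split.
  apply/forallP => i; rewrite lt0n; apply/negP => ai0.
  by have := card0_eq z0 i; rewrite !inE ai0.
apply/forallP => i; apply: h2 => // k kn; rewrite -cnt // z0 addn0; exact: h.
Qed.

Lemma sum_mult a : (\sum_(0 <= v < n.+1) mult a v = n)%N.
Proof.
rewrite big_mkord -[RHS]card_ord -sum1_card (partition_big a predT) //=.
apply: eq_bigr => v _; rewrite sum1dep_card /mult; apply: eq_card => i.
by rewrite !inE modn_small.
Qed.

Lemma cumulS a k : cumul a k.+1 = (cumul a k + mult a k.+1)%N.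
Proof. by rewrite /cumul big_nat_recr. Qed.

Lemma cumul_period a k : cumul a (k + n.+1) = (cumul a k + n)%N.
Proof.
elim: k => [|k IH].
  rewrite add0n [in RHS]/cumul big_geq // add0n -[in RHS](sum_mult a).
  rewrite /cumul big_nat_recr //= [in RHS]big_ltn // [RHS]addnC; congr (_ + _)%N.
  by rewrite /mult modnn mod0n.
by rewrite addSn !cumulS IH /mult -addSn modnDr addnAC.
Qed.

Definition rotate r a : {ffun 'I_n -> 'I_n.+1} := [ffun i => a i + r].

Lemma rotateK r : cancel (rotate r) (rotate (- r)).
Proof. by move=> a; apply/ffunP => i; rewrite !ffunE addrK. Qed.

Lemma cumul_rotate r a k :
  (cumul (rotate (- r) a) k + cumul a r = cumul a (r + k))%N.
Proof.
elim: k => [|k IH]; first by rewrite addn0 {1}/cumul big_geq.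
rewrite addnS !cumulS -IH addnAC; congr (_ + _)%N.
apply: eq_card => i; rewrite !inE ffunE.
have -> : (val (a i - r)%R == k.+1 %% n.+1)%N = (a i - r == inZp k.+1) by [].
rewrite subr_eq.
by rewrite -val_eqE /= modnDml addSn addnC.
Qed.

Lemma parking_rotation_unique a (r1 r2 : 'I_n.+1) :
  is_parking (rotate (- r1) a) -> is_parking (rotate (- r2) a) -> r1 = r2.
Proof.
wlog: r1 r2 / (r1 < r2)%N => [hw|lt12] /is_parkingP p1 /is_parkingP p2.
  have [lt|lt|/val_inj //] := ltngtP r1 r2; last apply/esym; apply: hw => //;
  exact/is_parkingP.
have lt2 := ltn_ord r2.
have := p1 (r2 - r1)%N; have := p2 (r1 + n.+1 - r2)%N.
have := cumul_rotate r1 a (r2 - r1)%N; have := cumul_rotate r2 a (r1 + n.+1 - r2)%N.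
rewrite !subnKC ?cumul_period; lia.
Qed.

(* Cycle lemma: rotate at the first minimum of cumul a k - k. *)
Lemma parking_rotation_exists a : exists r, is_parking (rotate (- r) a).
Proof.
pose f (i : 'I_n.+1) := ((cumul a i + (n - i)) * n.+1 + i)%N.
case: (@arg_minnP _ ord0 predT f) => // r _ min_r.
exists r; apply/is_parkingP => k kn.
have := cumul_rotate r a k; have lt_r := ltn_ord r.
have [lt|ge] := ltnP (r + k) n.+1.
  have := min_r (Ordinal lt) isT; rewrite /f /=.
  move: (cumul a r) (cumul a (r + k)) => u v; nia.
have lt' : (r + k - n.+1 < n.+1)%N by lia.
have := min_r (Ordinal lt') isT; rewrite /f /=.
have e := cumul_period a (r + k - n.+1); rewrite subnK // in e; rewrite e.
move: (cumul a r) (cumul a (r + k - n.+1)) => u v; nia.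
Qed.

Lemma pf_act_rotate s r a : (pf_act s (rotate r a) == rotate r a) = (pf_act s a == a).
Proof.
apply/eqP/eqP => /ffunP h; apply/ffunP => i; have := h i; rewrite !ffunE => //.
  exact: addIr.
by move->.
Qed.

Lemma pf_char_rotations (s : 'S_n) :
  (n.+1 * pf_char s)%N = #|[set a : {ffun 'I_n -> 'I_n.+1} | pf_act s a == a]|.
Proof.
rewrite -[RHS]sum1_card.
rewrite (eq_bigr (fun a => \sum_(r : 'I_n.+1 | is_parking (rotate (- r) a)) 1)%N).
  rewrite (exchange_big_dep predT) //= -{1}[n.+1]card_ord -sum_nat_const.
  apply: eq_bigr => r _; rewrite sum1dep_card /pf_char.
  rewrite -(card_imset _ (can_inj (rotateK r))); apply: eq_card => a.
  rewrite !inE; apply/imsetP/andP => [[b]|[fx pk]].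
    rewrite inE => /andP[pb fb] ->; rewrite pf_act_rotate fb; split=> //.
    by rewrite rotateK.
  exists (rotate (- r) a); first by rewrite inE pk pf_act_rotate.
  by have := rotateK (- r) a; rewrite opprK.
move=> a _; have [r pr] := parking_rotation_exists a.
rewrite (bigD1 r) //= big1 // => r' /andP[pr' /eqP[]].
exact: parking_rotation_unique pr' pr.
Qed.
End Pollak.

Lemma card_fixed_functions n q (s : 'S_n) :
  #|[set a : {ffun 'I_n -> 'I_q.+1} | [ffun i => a (s^-1%g i)] == a]|
  = (q.+1 ^ #|porbits s|)%N.
Proof.
pose g0 : 'I_q.+1 := ord0.
have := card_pffun_on g0 (mem (porbits s)) (mem [set: 'I_q.+1]).
rewrite cardsT card_ord => <-.
pose h (g : {ffun {set 'I_n} -> 'I_q.+1}) := [ffun i => g (porbit s i)].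
have hinj : {in pffun_on g0 (mem (porbits s)) (mem [set: 'I_q.+1]) &, injective h}.
  move=> g1 g2 /pffun_onP[s1 _] /pffun_onP[s2 _] /ffunP e.
  apply/ffunP => c; have [/imsetP[i _ ->]|nc] := boolP (c \in porbits s).
    by have := e i; rewrite !ffunE.
  have /eqP -> : g1 c == g0 by apply: contraNT nc => /(subsetP s1).
  by apply/esym/eqP; apply: contraNT nc => /(subsetP s2).
rewrite -(card_in_imset hinj); apply: eq_card => a; rewrite !inE.
apply/eqP/imsetP => [/ffunP fx|[g _ ->]]; last first.
  apply/ffunP => i; rewrite !ffunE -(porbit_perm s 1 (s^-1%g i)).
  by rewrite expg1 permKV.
have fx1 i : a (s i) = a i by have := fx (s i); rewrite ffunE permK => ->.
have fxk i k : a ((s ^+ k)%g i) = a i.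
  by elim: k => [|k IH]; rewrite ?perm1 // expgSr permM fx1.
exists [ffun c => if c \in porbits s then oapp a g0 [pick i in c] else g0].
  apply/pffun_onP; split=> [|y _]; last by rewrite inE.
  by apply/subsetP => c; rewrite !inE ffunE; case: ifP => //; rewrite eqxx.
apply/ffunP => i; rewrite !ffunE imset_f //.
case: pickP => [j /porbitP[k ->]|/(_ i)]; first by rewrite /= fxk.
by rewrite porbit_id.
Qed.

Lemma pf_charE n (s : 'S_n) : (n.+1 * pf_char s = n.+1 ^ #|porbits s|)%N.
Proof. by rewrite pf_char_rotations -card_fixed_functions. Qed.

(** * Cycle sums of the symmetric group *)


Section CycleInsertion.
Variables (n : nat) (i : 'I_n.+1).
Implicit Types (s : 'S_n) (j : 'I_n.+1).

Definition insert_perm j s : 'S_n.+1 := (lift_perm i i s * tperm i j)%g.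

Lemma insert_perm_id j s : insert_perm j s i = j.
Proof. by rewrite permM lift_perm_id tpermL. Qed.

Lemma insert_perm_lift j s x :
  lift i (s x) != j -> insert_perm j s (lift i x) = lift i (s x).
Proof.
by move=> ne; rewrite permM lift_perm_lift tpermD // 1?eq_sym // eq_sym neq_lift.
Qed.

Lemma porbit_insert j s x :
  (forall y, y \in porbit s x -> lift i y != j) ->
  porbit (insert_perm j s) (lift i x) = lift i @: porbit s x.
Proof.
move=> h.
have e m : ((insert_perm j s) ^+ m)%g (lift i x) = lift i ((s ^+ m)%g x).
  elim: m => [|m IH]; first by rewrite !perm1.
  rewrite expgSr permM IH insert_perm_lift ?expgSr ?permM // -permM -expgSr.
  by apply: h; apply: mem_porbit.
apply/setP => y; apply/porbitP/imsetP => [[m ->]|[y' /porbitP[m ->] ->]].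
  by rewrite e; exists ((s ^+ m)%g x) => //; apply: mem_porbit.
by exists m; rewrite e.
Qed.

Lemma mem_porbit_insert_id j s x :
  (lift i x \in porbit (insert_perm j s) i) = [exists y in porbit s x, lift i y == j].
Proof.
apply/idP/idP => [|/existsP[y /andP[yx /eqP ej]]].
  apply: contraLR; rewrite negb_exists => /forallP h; rewrite porbit_sym porbit_insert.
    by apply/imsetP => -[y _ /eqP]; rewrite (negbTE (neq_lift _ _)).
  by move=> y yx; have := h y; rewrite yx.
move: yx; rewrite porbit_sym => /porbitP[m ->]; elim: m => [|m IH].
  by rewrite perm1 ej -{1}(insert_perm_id j s); apply: (mem_porbit _ 1).
rewrite expgSr permM; set w := (s ^+ m)%g y in IH *.
have [e|ne] := eqVneq (lift i (s w)) j.
  by rewrite e -{1}(insert_perm_id j s); apply: (mem_porbit _ 1).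
rewrite -(insert_perm_lift ne) -eq_porbit_mem.
rewrite -eq_porbit_mem in IH.
by rewrite -(eqP IH); apply/eqP; apply: (porbit_perm _ 1).
Qed.

Lemma porbits_insert j s :
  [set c in porbits (insert_perm j s) | c != porbit (insert_perm j s) i] =
  (fun c : {set 'I_n} => lift i @: c) @:
    [set c in porbits s | [forall y in c, lift i y != j]].
Proof.
apply/setP => c; rewrite inE; apply/andP/imsetP => [[/imsetP[w _ ->]]|[c']].
  case: (unliftP i w) => [x ->|->]; last by rewrite eqxx.
  rewrite eq_porbit_mem mem_porbit_insert_id negb_exists => /forallP h.
  have h' y : y \in porbit s x -> lift i y != j.
    by move=> yx; have := h y; rewrite yx.
  exists (porbit s x); last exact: porbit_insert.
  by rewrite inE imset_f //=; apply/forall_inP.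
rewrite inE => /andP[/imsetP[x _ ->] /forall_inP h] ->.
rewrite -(porbit_insert h) imset_f //; split=> //.
rewrite eq_porbit_mem mem_porbit_insert_id; apply/existsPn => y.
by apply/negP => /andP[yx]; apply/negP; apply: h.
Qed.

Lemma insert_perm_inj : injective (fun js => insert_perm js.1 js.2).
Proof.
move=> [j1 s1] [j2 s2] /= e.
have ej : j1 = j2 by rewrite -(insert_perm_id j1 s1) e insert_perm_id.
move: e; rewrite /insert_perm ej => /mulIg e; congr (_, _); apply/permP => x.
by have := congr1 (fun u : 'S_n.+1 => u (lift i x)) e; rewrite !lift_perm_lift => /lift_inj.
Qed.

Lemma big_insert_perm (R : nmodType) (F : 'S_n.+1 -> R) :
  \sum_s F s = \sum_j \sum_s F (insert_perm j s).
Proof.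
rewrite pair_bigA; apply: reindex; apply: onW_bij; apply: inj_card_bij.
  exact: insert_perm_inj.
by rewrite card_prod card_ord !card_Sn factS.
Qed.
End CycleInsertion.

Section CycleIndex.
Variables (R : comNzRingType) (z : nat -> R).

Definition cycle_weight n (s : 'S_n) : R := \prod_(c in porbits s) z #|c|.

Definition cycle_sum n : R := \sum_(s : 'S_n) cycle_weight s.

Definition marked_weight k n (s : 'S_n) (i : 'I_n) : R :=
  z (#|porbit s i| + k) * \prod_(c in porbits s | c != porbit s i) z #|c|.

Lemma marked_weight0 n (s : 'S_n) i : marked_weight 0 s i = cycle_weight s.
Proof. by rewrite /cycle_weight (bigD1 (porbit s i)) ?imset_f //= /marked_weight addn0. Qed.

Lemma prod_porbits_insert n (i j : 'I_n.+1) (s : 'S_n) :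
  \prod_(c in porbits (insert_perm i j s) | c != porbit (insert_perm i j s) i) z #|c| =
  \prod_(c in porbits s | [forall y in c, lift i y != j]) z #|c|.
Proof.
rewrite (eq_bigl (mem [set c in porbits (insert_perm i j s) |
   c != porbit (insert_perm i j s) i])) => [|c]; last by rewrite /= inE.
rewrite porbits_insert big_imset /=; last first.
  by move=> c1 c2 _ _; apply: imset_inj; apply: lift_inj.
apply: eq_big => c; first by rewrite inE.
by rewrite card_imset //; apply: lift_inj.
Qed.

Lemma marked_weight_insert_id k n (i : 'I_n.+1) (s : 'S_n) :
  marked_weight k (insert_perm i i s) i = z k.+1 * cycle_weight s.
Proof.
rewrite /marked_weight prod_porbits_insert; congr (z _ * _).
  rewrite (_ : porbit _ _ = [set i]) ?cards1 //; apply/setP => w.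
  rewrite inE; case: (unliftP i w) => [x ->|->]; last by rewrite porbit_id eqxx.
  rewrite mem_porbit_insert_id [RHS]eq_sym (negbTE (neq_lift _ _)); apply/existsP.
  by move=> [y /andP[_]]; rewrite eq_sym (negbTE (neq_lift _ _)).
apply: eq_bigl => c; rewrite -[RHS]andbT; congr (_ && _).
by apply/forall_inP => y _; rewrite eq_sym neq_lift.
Qed.

Lemma marked_weight_insert_lift k n (i : 'I_n.+1) j (s : 'S_n) :
  marked_weight k (insert_perm i (lift i j) s) i = marked_weight k.+1 s j.
Proof.
rewrite /marked_weight prod_porbits_insert; congr (z _ * _).
  rewrite (_ : porbit _ _ = i |: lift i @: porbit s j).
    rewrite cardsU1 card_imset; last exact: lift_inj.
    rewrite (_ : i \in _ = false) ?add1n ?addSnnS //.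
    by apply/imsetP => -[y _ /eqP]; rewrite (negbTE (neq_lift _ _)).
  apply/setP => w; rewrite !inE.
  case: (unliftP i w) => [x ->|->]; last by rewrite porbit_id eqxx.
  rewrite mem_porbit_insert_id [X in X || _]eq_sym (negbTE (neq_lift _ _)) /=.
  rewrite mem_imset; last exact: lift_inj.
  apply/existsP/idP => [[y /andP[yx /eqP/lift_inj <-]]|xj]; first by rewrite porbit_sym.
  by exists j; rewrite porbit_sym xj eqxx.
apply: eq_bigl => c; case: (boolP (c \in _)) => //= /imsetP[x _ ->].
rewrite eq_porbit_mem; apply/forall_inP/idP => [h|].
  by apply/negP; rewrite porbit_sym => /h; rewrite eqxx.
by move=> nx y yx; apply: contraNneq nx => /lift_inj <-; rewrite porbit_sym.
Qed.

Definition marked_sum k n : R := \sum_(i < n) \sum_(s : 'S_n) marked_weight k s i.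

Lemma marked_sumS k n :
  marked_sum k n.+1 = n.+1%:R * (z k.+1 * cycle_sum n + marked_sum k.+1 n).
Proof.
rewrite /marked_sum (eq_bigr (fun=> z k.+1 * cycle_sum n + marked_sum k.+1 n)).
  by rewrite sumr_const card_ord mulr_natl.
move=> i _; rewrite (big_insert_perm i) (bigD1 i) //=; congr (_ + _).
  by rewrite /cycle_sum mulr_sumr; apply: eq_bigr => s _; apply: marked_weight_insert_id.
rewrite (reindex_omap (lift i) (unlift i)) /=; last first.
  by move=> j; case: (unliftP i j) => [x ->|-> /eqP] //=; rewrite liftK.
apply: eq_big => [j|j _]; first by rewrite liftK eqxx eq_sym neq_lift.
by apply: eq_bigr => s _; apply: marked_weight_insert_lift.
Qed.

Lemma cycle_sum_recurrence (h : nat -> R) :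
  (forall m, cycle_sum m = m`!%:R * h m) ->
  forall n, n`!%:R * (n%:R * h n) = n`!%:R * \sum_(j < n) z j.+1 * h (n - j.+1)%N.
Proof.
move=> hE n.
have Phi k : marked_sum k n = n`!%:R * \sum_(j < n) z (k + j).+1 * h (n - j.+1)%N.
  elim: n k => [|m IH] k; first by rewrite /marked_sum !big_ord0 mulr0.
  rewrite marked_sumS IH hE factS natrM -mulrA; congr (_ * _).
  rewrite mulrCA -mulrDr big_ord_recl addn0 subSS subn0; congr (_ * (_ + _)).
  by apply: eq_bigr => j _; rewrite /= /bump /= add1n addSnnS subSS.
rewrite -(Phi 0%N) mulrCA -hE /marked_sum (eq_bigr (fun=> cycle_sum n)).
  by rewrite sumr_const card_ord mulr_natl.
by move=> i _; apply: eq_bigr => s _; rewrite marked_weight0.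
Qed.
End CycleIndex.

(** * Strict partitions and the six-vertex model *)


Fixpoint bits (n : nat) : seq bitseq :=
  if n is n'.+1 then map (cons true) (bits n') ++ map (cons false) (bits n')
  else [:: [::]].

Lemma mem_bits n b : (b \in bits n) = (size b == n).
Proof.
elim: n b => [|n IHn] [|c b] //=; rewrite mem_cat.
  by apply/negbTE/negP => /orP[] /mapP[].
rewrite eqSS -IHn; apply/orP/idP => [[] /mapP[b' Hb'] [_ ->] //|Hb].
by case: c; [left|right]; apply/mapP; exists b.
Qed.

Lemma bits_uniq n : uniq (bits n).
Proof.
elim: n => //= n IHn; rewrite cat_uniq !map_inj_uniq ?IHn ?andbT; try by move=> ? ? [].
by rewrite /=; apply/hasPn => _ /mapP[b _ ->]; apply/negP => /mapP[].
Qed.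

Lemma big_bitsS (R : nmodType) n (F : bitseq -> R) :
  \sum_(b <- bits n.+1) F b =
  \sum_(b <- bits n) F (true :: b) + \sum_(b <- bits n) F (false :: b).
Proof. by rewrite /= big_cat !big_map. Qed.

(* The parts of the strict partition coded by b: the head of b tells whether size b is a part. *)
Fixpoint parts (b : bitseq) : seq nat :=
  if b is c :: b' then (if c then [:: (size b').+1] else [::]) ++ parts b' else [::].

Definition nobits n : bitseq := nseq n false.

Section Vertex.
Variable R : comNzRingType.
Implicit Types (x y : R) (h : bool) (b l m : bitseq).

(* Six-vertex weights; the state h says that a part of the larger partition has been read whose
   interlacing part of the smaller one is still to come, and c, d are the two occupancies. *)
Definition vwt (start stop x : R) (h c d : bool) : R :=
  match h, c, d with
  | false, false, false => 1
  | false, true, true => 1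
  | false, true, false => start
  | true, false, false => x
  | true, true, true => x
  | true, false, true => stop
  | _, _, _ => 0
  end.

Fixpoint vrow (start stop x : R) h l m : R :=
  match l, m with
  | c :: l', d :: m' => vwt start stop x h c d * vrow start stop x (h (+) c (+) d) l' m'
  | _, _ => if h then x else 1
  end.

Definition VP x := vrow 1 (2%:R * x) x.
Definition VQ x := vrow 2%:R x x.

Definition ZA x y h1 h2 m1 m2 : R :=
  \sum_(l <- bits (size m1)) VQ x h1 l m1 * VP y h2 l m2.
Definition ZB x y h1 h2 m1 m2 : R :=
  \sum_(k <- bits (size m1)) VP y h2 m1 k * VQ x h1 m2 k.

Lemma ZA_cons x y h1 h2 c1 c2 m1 m2 :
  ZA x y h1 h2 (c1 :: m1) (c2 :: m2) =
    vwt 2%:R x x h1 true c1 * vwt 1 (2%:R * y) y h2 true c2 *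
      ZA x y (h1 (+) true (+) c1) (h2 (+) true (+) c2) m1 m2 +
    vwt 2%:R x x h1 false c1 * vwt 1 (2%:R * y) y h2 false c2 *
      ZA x y (h1 (+) false (+) c1) (h2 (+) false (+) c2) m1 m2.
Proof.
rewrite {1}/ZA [size _]/= big_bitsS !mulr_sumr.
by congr (_ + _); apply: eq_bigr => l _; rewrite /VQ /VP /= mulrACA.
Qed.

Lemma ZB_cons x y h1 h2 c1 c2 m1 m2 :
  ZB x y h1 h2 (c1 :: m1) (c2 :: m2) =
    vwt 1 (2%:R * y) y h2 c1 true * vwt 2%:R x x h1 c2 true *
      ZB x y (h1 (+) c2 (+) true) (h2 (+) c1 (+) true) m1 m2 +
    vwt 1 (2%:R * y) y h2 c1 false * vwt 2%:R x x h1 c2 false *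
      ZB x y (h1 (+) c2 (+) false) (h2 (+) c1 (+) false) m1 m2.
Proof.
rewrite {1}/ZB [size _]/= big_bitsS !mulr_sumr.
by congr (_ + _); apply: eq_bigr => l _; rewrite /VQ /VP /= mulrACA.
Qed.

Lemma yang_baxter x y m1 m2 : size m1 = size m2 ->
  [/\ (1 - x * y) * ZA x y false false m1 m2 + 2%:R * ZA x y true true m1 m2
      = (1 + x * y) * ZB x y false false m1 m2,
      ZA x y false false m1 m2 + ZA x y true true m1 m2
      = ZB x y false false m1 m2 + ZB x y true true m1 m2,
      ZA x y true false m1 m2 = ZB x y true false m1 m2 &
      ZA x y false true m1 m2 = ZB x y false true m1 m2].
Proof.
elim: m1 m2 => [|c1 m1 IH] [|c2 m2] //=.
  by move=> _; rewrite /ZA /ZB /= !big_seq1 /VQ /VP /=; split; ring.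
case=> /IH[e1 e2 e3 e4]; rewrite !ZA_cons !ZB_cons.
have e1' : x * y * ZB x y false false m1 m2 = (1 - x * y) * ZA x y false false m1 m2
  + 2%:R * ZA x y true true m1 m2 - ZB x y false false m1 m2 by rewrite e1; ring.
have e2' : ZB x y true true m1 m2 = ZA x y false false m1 m2 + ZA x y true true m1 m2
  - ZB x y false false m1 m2 by rewrite e2; ring.
by case: c1; case: c2; rewrite /= ?e3 ?e4 ?e2'; split; ring: e1'.
Qed.

Lemma VQ_scale t x h l m : size l = size m ->
  VQ (t * x) h l m * t ^+ sumn (parts m) =
  t ^+ (h * (size l).+1 + sumn (parts l)) * VQ x h l m.
Proof.
elim: l m h => [|c l IH] [|d m] h //=.
  by rewrite muln1 addn0; case: h; rewrite /VQ /= ?expr1 ?expr0 ?mulr1.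
move=> [e]; rewrite !sumn_cat /VQ /= -!/(VQ _ _ _ _) -e.
have {IH} := IH m (h (+) c (+) d) e.
have E (b : bool) k : t ^+ (b * k) = if b then t ^+ k else 1.
  by case: b; rewrite ?mul1n ?mul0n.
have F (b : bool) k : t ^+ sumn (if b then [:: k] else [::]) = if b then t ^+ k else 1.
  by case: b; rewrite //= addn0.
rewrite !exprD !E !F [t ^+ (size l).+2]exprS.
move: (t ^+ (size l).+1) (t ^+ sumn (parts l)) (t ^+ sumn (parts m)) => T1 T2 T3.
move: (VQ (t * x) _ _ _) (VQ x _ _ _) => V1 V2.
by case: h; case: c; case: d => /= IH; rewrite ?mul0r ?mulr0 //; ring: IH.
Qed.

Lemma VQ_VP x h l m : size l = size m ->
  VQ x h l m * 2%:R ^+ size (parts m) = 2%:R ^+ size (parts l) * VP x h l m.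
Proof.
elim: l m h => [|c l IH] [|d m] h //=; first by rewrite expr0 mulr1 mul1r.
case=> e.
rewrite !size_cat /VQ /VP /= -/(VQ _ _ _ _) -/(VP _ _ _ _).
have {IH} := IH m (h (+) c (+) d) e.
have E (b : bool) : 2%:R ^+ size (if b then [:: (size l).+1] else [::]) =
   if b then 2%:R else 1 :> R by case: b.
have F (b : bool) : 2%:R ^+ size (if b then [:: (size m).+1] else [::]) =
   if b then 2%:R else 1 :> R by case: b.
rewrite !exprD E F.
move: (_ ^+ size (parts l)) (_ ^+ size (parts m)) => T1 T2.
move: (VQ x _ _ _) (VP x _ _ _) => V1 V2.
by case: h; case: c; case: d => /= IH; rewrite ?mul0r ?mulr0 //; ring: IH.
Qed.

Lemma vrow_nobits start stop x m :
  vrow start stop x false (nobits (size m)) m = (m == nobits (size m))%:R.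
Proof. by elim: m => //= -[] m IH; rewrite ?mul0r // mul1r IH. Qed.

Fixpoint Pvec (x : nat -> R) N b : R :=
  if N is N'.+1 then \sum_(m <- bits (size b)) VP (x N') false b m * Pvec x N' m
  else (b == nobits (size b))%:R.

Fixpoint Qvec (x : nat -> R) N b : R :=
  if N is N'.+1 then \sum_(m <- bits (size b)) VQ (x N') false b m * Qvec x N' m
  else (b == nobits (size b))%:R.

Lemma parts_nobits n : parts (nobits n) = [::].
Proof. by elim: n. Qed.

Lemma Qvec_Pvec (x : nat -> R) N b : Qvec x N b = 2%:R ^+ size (parts b) * Pvec x N b.
Proof.
elim: N b => [|N IH] b /=.
  by case: eqP => [->|_]; rewrite ?mulr0 // parts_nobits mul1r.
rewrite mulr_sumr; apply: eq_big_seq => m; rewrite mem_bits => /eqP e.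
by rewrite IH mulrA VQ_VP // mulrA.
Qed.

Lemma Qvec_scale t (x : nat -> R) N b :
  Qvec (fun i => t * x i) N b = t ^+ sumn (parts b) * Qvec x N b.
Proof.
elim: N b => [|N IH] b /=.
  by case: eqP => [->|_]; rewrite ?mulr0 // parts_nobits mul1r.
rewrite mulr_sumr; apply: eq_big_seq => m; rewrite mem_bits => /eqP e.
by rewrite IH mulrA VQ_scale // mulrA.
Qed.

Lemma size_nobits n : size (nobits n) = n.
Proof. exact: size_nseq. Qed.

Lemma big_bits_nobits n (F : bitseq -> R) :
  \sum_(b <- bits n) (b == nobits n)%:R * F b = F (nobits n).
Proof.
rewrite (bigD1_seq (nobits n)) ?mem_bits ?size_nobits ?bits_uniq //= eqxx mul1r.
by rewrite big1 ?addr0 // => b /negbTE->; rewrite mul0r.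
Qed.

Lemma Qvec_nobits (x : nat -> R) N n : Qvec x N (nobits n) = 1.
Proof.
elim: N => [|N IH] /=; first by rewrite size_nobits eqxx.
rewrite size_nobits -IH -[RHS](big_bits_nobits n (Qvec x N)).
apply: eq_big_seq => m; rewrite mem_bits => /eqP {1 2}<-.
by rewrite /VQ vrow_nobits.
Qed.
End Vertex.

Section TruncatedSeries.
Variable R : comNzRingType.
Implicit Types p q : {poly R}.

Definition eqmodX n p q := forall i, (i < n)%N -> p`_i = q`_i.

Lemma eqmodX_refl n p : eqmodX n p p. Proof. by []. Qed.

Lemma eqmodX_trans n q p r : eqmodX n p q -> eqmodX n q r -> eqmodX n p r.
Proof. by move=> h1 h2 i hi; rewrite h1 ?h2. Qed.

Lemma eqmodX_sym n p q : eqmodX n p q -> eqmodX n q p.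
Proof. by move=> h i hi; rewrite h. Qed.

Lemma eqmodXD n p q p' q' :
  eqmodX n p q -> eqmodX n p' q' -> eqmodX n (p + p') (q + q').
Proof. by move=> h1 h2 i hi; rewrite !coefD h1 ?h2. Qed.

Lemma eqmodXB n p q p' q' :
  eqmodX n p q -> eqmodX n p' q' -> eqmodX n (p - p') (q - q').
Proof. by move=> h1 h2 i hi; rewrite !coefB h1 ?h2. Qed.

Lemma eqmodXM n p q p' q' :
  eqmodX n p q -> eqmodX n p' q' -> eqmodX n (p * p') (q * q').
Proof.
move=> h1 h2 i hi; rewrite !coefM; apply: eq_bigr => j _.
by rewrite h1 ?h2 //; move: (ltn_ord j); lia.
Qed.

Lemma eqmodX_sum n (I : eqType) (r : seq I) (F G : I -> {poly R}) :
  (forall i, i \in r -> eqmodX n (F i) (G i)) ->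
  eqmodX n (\sum_(i <- r) F i) (\sum_(i <- r) G i).
Proof.
move=> h i hi; rewrite !coef_sum; apply: eq_big_seq => j jr; exact: h.
Qed.

Lemma eqmodX_sum0 n (I : eqType) (r : seq I) (F : I -> {poly R}) :
  (forall i, i \in r -> eqmodX n (F i) 0) -> eqmodX n (\sum_(i <- r) F i) 0.
Proof.
move=> h i hi; rewrite coef_sum coef0 big_seq big1 // => j jr.
by rewrite h // coef0.
Qed.

Lemma eqmodX_Xn n k p : (n <= k)%N -> eqmodX n ('X^k * p) 0.
Proof. by move=> nk i hi; rewrite coefXnM coef0 (leq_trans hi nk). Qed.

Lemma eqmodX_cancel n (a p q : {poly R}) :
  a`_0 = 1 -> eqmodX n (a * p) (a * q) -> eqmodX n p q.
Proof.
move=> a0 h i; elim/ltn_ind: i => i IH hi.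
have := h i hi; rewrite !coefM !big_ord_recl /= a0 subn0 !mul1r.
have -> : \sum_(j < i) a`_(bump 0 j) * p`_(i - bump 0 j)
  = \sum_(j < i) a`_(bump 0 j) * q`_(i - bump 0 j).
  by apply: eq_bigr => j _; rewrite IH // /bump; move: (ltn_ord j); lia.
exact: addIr.
Qed.
End TruncatedSeries.

Section Cauchy.
Variable R : comNzRingType.
Variable n : nat.
Implicit Types (x y : nat -> R).

Lemma Cauchy_step (x : nat -> R) (y : {poly R}) N m : size m = n ->
  let X i := 'X * (x i)%:P in
  eqmodX n.+1
    (\prod_(i < N) (1 - X i * y) * \sum_(l <- bits n) Qvec X N l * VP y false l m)
    (\prod_(i < N) (1 + X i * y) * Qvec X N m).
Proof.
move=> sm X; elim: N m sm => [|N IH] m sm.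
  rewrite !big_ord0 !mul1r /= (_ : \sum_(l <- _) _ = (m == nobits (size m))%:R) //.
  rewrite -(vrow_nobits 1 (2%:R * y) y) sm -/(VP y false (nobits n) m).
  rewrite -(big_bits_nobits n (fun l => VP y false l m)).
  by apply: eq_big_seq => l; rewrite mem_bits => /eqP->.
rewrite !big_ord_recr /=.
set A := \prod_(i < N) _; set B := \prod_(i < N) _.
have -> : A * (1 - X N * y) * (\sum_(l <- bits n) (\sum_(k <- bits (size l))
     VQ (X N) false l k * Qvec X N k) * VP y false l m) =
  (1 + X N * y) * \sum_(k <- bits n) VQ (X N) false m k *
      (A * \sum_(l <- bits n) Qvec X N l * VP y false l k)
  - A * 2%:R * \sum_(k <- bits n) Qvec X N k * ZA (X N) y true true k m.
  have -> : \sum_(l <- bits n) (\sum_(k <- bits (size l))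
     VQ (X N) false l k * Qvec X N k) * VP y false l m =
     \sum_(k <- bits n) Qvec X N k * ZA (X N) y false false k m.
    rewrite (eq_big_seq (fun l => \sum_(k <- bits n)
       Qvec X N k * (VQ (X N) false l k * VP y false l m))); last first.
      move=> l; rewrite mem_bits => /eqP->; rewrite mulr_suml.
      by apply: eq_bigr => k _; rewrite mulrCA mulrA.
    rewrite exchange_big; apply: eq_big_seq => k; rewrite mem_bits => /eqP sk.
    by rewrite -mulr_sumr /ZA sk.
  have -> : \sum_(k <- bits n) VQ (X N) false m k *
      (A * \sum_(l <- bits n) Qvec X N l * VP y false l k) =
      A * \sum_(l <- bits n) Qvec X N l * ZB (X N) y false false l m.
    rewrite (eq_bigr (fun k => \sum_(l <- bits n)
      A * (Qvec X N l * (VP y false l k * VQ (X N) false m k)))).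
      rewrite exchange_big mulr_sumr; apply: eq_big_seq => l.
      by rewrite mem_bits => /eqP sl; rewrite /ZB sl !mulr_sumr.
    by move=> k _; rewrite !mulr_sumr; apply: eq_bigr => l _; ring.
  rewrite [_ * (A * _)]mulrCA -!(mulrA A) -mulrBr; congr (A * _).
  rewrite !mulr_sumr -sumrB; apply: eq_big_seq => k; rewrite mem_bits => /eqP sk.
  have [e _ _ _] := @yang_baxter _ (X N) y k m (etrans sk (esym sm)).
  by rewrite mulrCA [(1 + _) * (_ * _)]mulrCA -e; ring.
rewrite [B * _]mulrC -(mulrA (1 + _)) -[X in eqmodX _ _ X]subr0; apply: eqmodXB.
  apply: (eqmodXM (@eqmodX_refl _ _ _)); rewrite sm mulr_sumr; apply: eqmodX_sum => k.
  rewrite mem_bits => /eqP /IH e; rewrite [B * _]mulrCA.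
  exact: (eqmodXM (@eqmodX_refl _ _ _)).
rewrite -[X in eqmodX _ _ X](mulr0 (A * 2%:R)); apply: eqmodXM => //.
apply: eqmodX_sum0 => k.
rewrite mem_bits => /eqP sk; rewrite /ZA sk mulr_sumr.
apply: eqmodX_sum0 => l.
rewrite mem_bits => /eqP sl.
rewrite Qvec_scale mulrA [_ * Qvec _ _ _ * _]mulrAC [_ * VQ _ _ _ _]mulrC.
rewrite VQ_scale ?sl ?sk // -!mulrA mul1n exprD -!mulrA.
exact: eqmodX_Xn.
Qed.

Lemma Cauchy x y N M : 
  let X i := 'X * (x i)%:P in
  eqmodX n.+1
    (\prod_(j < M) \prod_(i < N) (1 - X i * (y j)%:P) *
      \sum_(l <- bits n) Qvec X N l * Pvec (fun j => (y j)%:P) M l)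
    (\prod_(j < M) \prod_(i < N) (1 + X i * (y j)%:P)).
Proof.
move=> X; elim: M => [|M IH].
  rewrite !big_ord0 mul1r /= (_ : \sum_(l <- _) _ = 1) //.
  rewrite -[RHS](Qvec_nobits X N n) -[RHS](big_bits_nobits n (Qvec X N)).
  by apply: eq_big_seq => l; rewrite mem_bits mulrC => /eqP->.
rewrite !big_ord_recr /=.
have -> : \sum_(l <- bits n) Qvec X N l * (\sum_(m <- bits (size l))
     VP (y M)%:P false l m * Pvec (fun j => (y j)%:P) M m) =
   \sum_(m <- bits n) (\sum_(l <- bits n) Qvec X N l * VP (y M)%:P false l m)
     * Pvec (fun j => (y j)%:P) M m.
  under [RHS]eq_bigr => m _ do rewrite mulr_suml.
  rewrite [RHS]exchange_big; apply: eq_big_seq => l.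
  rewrite mem_bits => /eqP->; rewrite mulr_sumr.
  by apply: eq_bigr => m _; rewrite mulrA.
rewrite [X in eqmodX _ _ X]mulrC; set A := \prod_(j < M) _; set B := \prod_(i < N) _.
set C := \prod_(i < N) _.
apply: (@eqmodX_trans _ _ (C * (A * \sum_(l <- bits n) Qvec X N l *
   Pvec (fun j : nat => (y j)%:P) M l))); last exact: eqmodXM.
rewrite -mulrA [C * _]mulrCA; apply: eqmodXM => //.
rewrite !mulr_sumr; apply: eqmodX_sum => m; rewrite mem_bits => /eqP sm.
by rewrite !mulrA; apply: eqmodXM => //; apply: Cauchy_step.
Qed.
End Cauchy.

(** * Generating series of the cycle sums *)


Section LogDerivative.
Variables (R : idomainType) (n : nat).
Hypothesis char0 : forall k, k.+1%:R != 0 :> R.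

Lemma eqmodX_ode (B D : {poly R}) : B`_0 = 1 -> D`_0 = 0 ->
  eqmodX n (B * D^`()) (B^`() * D) -> eqmodX n.+1 D 0.
Proof.
move=> B0 D0 e i; rewrite coef0; elim/ltn_ind: i => -[|i] IH // hi.
have := e i hi; rewrite !coefM [RHS]big1 => [|j _]; last first.
  by rewrite IH ?mulr0 //; move: (ltn_ord j); lia.
rewrite big_ord_recl /= B0 mul1r subn0 big1 ?addr0 => [|j _]; last first.
  by rewrite coef_deriv IH ?mul0rn ?mulr0 //; move: (ltn_ord j); rewrite /bump; lia.
by rewrite coef_deriv -mulr_natr => /eqP; rewrite mulf_eq0 (negbTE (char0 i)) orbF => /eqP.
Qed.

Definition odd_psum (I : Type) (r : seq I) (a : I -> R) k : R :=
  if odd k then 2%:R * \sum_(c <- r) a c ^+ k else 0.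

Lemma log_derivative_odd_psum (I : Type) (r : seq I) (a : I -> R) :
  let A := \prod_(c <- r) (1 - 'X * (a c)%:P) in
  let B := \prod_(c <- r) (1 + 'X * (a c)%:P) in
  eqmodX n (A * B * \poly_(i < n) odd_psum r a i.+1) (B^`() * A - B * A^`()).
Proof.
elim: r => [|c r IH] /=.
  rewrite !big_nil !mul1r !derivC mul0r subr0 => i hi.
  rewrite coef_poly hi coef0 /odd_psum; case: ifP => // _.
  by rewrite big_nil mulr0.
rewrite !big_cons; move: IH => /=.
set A := \prod_(_ <- _) _; set B := \prod_(_ <- _) _ => IH.
set p := \poly_(i < n) _ in IH; set q := \poly_(i < n) _.
pose u := \poly_(i < n) (if odd i then 0 else 2%:R * a c ^+ i.+1).
have -> : q = u + p.
  apply/polyP => i; rewrite coefD !coef_poly; case: ifP => _; last by rewrite addr0.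
  rewrite /odd_psum /=; case: (odd i); rewrite /= ?addr0 //.
  by rewrite big_cons mulrDr.
have hu : eqmodX n ((1 - 'X^2 * (a c ^+ 2)%:P) * u) (2%:R * a c)%:P.
  move=> i hi; rewrite mulrBl mul1r coefB -mulrA coefXnM coefCM !coef_poly hi coefC.
  case: i hi => [|[|i]] hi //=; rewrite ?subr0 ?expr1 //.
  rewrite subn2 /= negbK (ltn_trans (ltnSn i) (ltn_trans (ltnSn _) hi)).
  by case: (odd i); rewrite ?mulr0 ?subr0 // !exprS; ring.
have -> : (1 - 'X * (a c)%:P) * A * ((1 + 'X * (a c)%:P) * B) * (u + p) =
  A * B * ((1 - 'X^2 * (a c ^+ 2)%:P) * u) +
  (1 - 'X^2 * (a c ^+ 2)%:P) * (A * B * p) by rewrite rmorphXn /=; ring.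
have -> : ((1 + 'X * (a c)%:P) * B)^`() * ((1 - 'X * (a c)%:P) * A) -
   (1 + 'X * (a c)%:P) * B * ((1 - 'X * (a c)%:P) * A)^`() =
   A * B * (2%:R * a c)%:P + (1 - 'X^2 * (a c ^+ 2)%:P) * (B^`() * A - B * A^`()).
  rewrite !derivE rmorphXn rmorphM rmorph_nat /=.
  by ring.
by apply: eqmodXD; apply: eqmodXM.
Qed.

Lemma newton_generating_series (I : Type) (r : seq I) (a : I -> R) (h : nat -> R) :
  h 0%N = 1 ->
  (forall k, k%:R * h k = \sum_(j < k) odd_psum r a j.+1 * h (k - j.+1)%N) ->
  eqmodX n.+1 (\prod_(c <- r) (1 - 'X * (a c)%:P) * \poly_(i < n.+1) h i)
    (\prod_(c <- r) (1 + 'X * (a c)%:P)).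
Proof.
move=> h0 hrec; set A := \prod_(_ <- _) _; set B := \prod_(_ <- _) _.
set W := \poly_(i < _) _; pose Z := \poly_(i < n) odd_psum r a i.+1.
have prod0 (f : I -> R) : (\prod_(c <- r) (1 + 'X * (f c)%:P))`_0 = 1.
  rewrite -horner_coef0 horner_prod big1 // => c _.
  by rewrite !hornerE ?mul0r ?addr0.
have B0 : B`_0 = 1 by apply: prod0.
have A0 : A`_0 = 1.
  rewrite (_ : A = \prod_(c <- r) (1 + 'X * (- a c)%:P)) ?(prod0 (fun c => - a c)) //.
  by apply: eq_bigr => c _; rewrite polyCN mulrN.
have W' : eqmodX n W^`() (Z * W).
  move=> i hi; rewrite coef_deriv coefM coef_poly ltnS hi -mulr_natl hrec.
  apply: eq_bigr => j _; rewrite subSS !coef_poly.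
  by rewrite !ifT //; move: (ltn_ord j); lia.
suff : eqmodX n.+1 (A * W - B) 0.
  by move=> e i hi; apply/eqP; rewrite -subr_eq0 -coefB e // coef0.
apply: (eqmodX_ode B0).
  rewrite coefB B0 coefM big_ord1 A0 coef_poly /= h0 mulr1; exact: subrr.
have l := @log_derivative_odd_psum I r a; rewrite /= -/A -/B -/Z in l.
rewrite derivB derivM mulrBr mulrDr.
have -> : B^`() * (A * W - B) = B * (A^`() * W) + (B^`() * A - B * A^`()) * W - B * B^`().
  by ring.
apply: eqmodXB => //; apply: eqmodXD => //.
apply: eqmodX_trans (eqmodXM l (@eqmodX_refl _ n W)).
rewrite mulrA [B * A]mulrC -[_ * Z * W]mulrA; exact: (eqmodXM (@eqmodX_refl _ _ _)).
Qed.
End LogDerivative.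

(** * Marked fillings of sets of cells *)


Definition left_of (p q : nat * nat) : bool := (p.1 == q.1) && (p.2 < q.2)%N.
Definition above (p q : nat * nat) : bool := (p.2 == q.2) && (p.1 < q.1)%N.

Section MarkedFillings.
Variables (R : comNzRingType) (N : nat) (C : finType) (pos : C -> nat * nat).
Variable x : nat -> R.
Implicit Types (D E S : {set C}) (T : {ffun C -> option (mletter N)}) (c : C).
Implicit Types (g : {ffun C -> bool}) (a : mletter N) (p : bool).

Definition pair_ok (p1 p2 : nat * nat) a1 a2 : bool :=
  [&& left_of p1 p2 ==> (mrank a1 <= mrank a2)%N,
      above p1 p2 ==> (mrank a1 <= mrank a2)%N,
      ((p1.1 == p2.1) && (p1 != p2) && (a1 == a2)) ==> ~~ a1.2 &
      ((p1.2 == p2.2) && (p1 != p2) && (a1 == a2)) ==> a1.2].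

Definition cell_ok k (p : nat * nat) a : bool :=
  ((p.1 == p.2) ==> ~~ a.2) && (a.1 < k)%N.

Definition filling_ok k D T : bool :=
  [&& [forall c, (T c != None) == (c \in D)],
   [forall c1, forall c2, match T c1, T c2 with
     | Some a1, Some a2 => pair_ok (pos c1) (pos c2) a1 a2
     | _, _ => true end] &
   [forall c, if T c is Some a then cell_ok k (pos c) a else true]].

Lemma filling_okP k D T : reflect
  [/\ forall c, (T c != None) = (c \in D),
      forall c1 c2 a1 a2, T c1 = Some a1 -> T c2 = Some a2 ->
        pair_ok (pos c1) (pos c2) a1 a2 &
      forall c a, T c = Some a -> cell_ok k (pos c) a]
  (filling_ok k D T).
Proof.
apply: (iffP and3P) => [[/forallP h1 /forallP h2 /forallP h3]|[h1 h2 h3]]; split.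
- by move=> c; have /eqP := h1 c.
- by move=> c1 c2 a1 a2 e1 e2; have /forallP/(_ c2) := h2 c1; rewrite e1 e2.
- by move=> c a e; have := h3 c; rewrite e.
- by apply/forallP => c; rewrite h1.
- apply/forallP => c1; apply/forallP => c2.
  case e1: (T c1) => [a1|] //; case e2: (T c2) => [a2|] //; exact: h2.
- by apply/forallP => c; case e: (T c) => [a|] //; apply: h3.
Qed.

Definition letter_weight (o : option (mletter N)) : R :=
  if o is Some a then x a.1 else 1.

Definition filling_sum k D : R :=
  \sum_(T : {ffun C -> option (mletter N)} | filling_ok k D T) \prod_c letter_weight (T c).

Definition small_cells k T : {set C} :=
  [set c | if T c is Some a then (a.1 < k)%N else false].

Definition mark_ok S c p : bool :=
  [&& p ==> [forall c' in S, ~~ left_of (pos c') (pos c)],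
      ~~ p ==> [forall c' in S, ~~ above (pos c) (pos c')] &
      p ==> ((pos c).1 != (pos c).2)].

Definition compatible D E : bool :=
  [forall c in D :\: E, forall c' in E,
     ~~ left_of (pos c) (pos c') && ~~ above (pos c) (pos c')].

Section Glue.
Variables (k : nat) (kN : (k < N)%N) (D E : {set C}).
Let kk : 'I_N := Ordinal kN.

Definition glue (Tg : {ffun C -> option (mletter N)} * {ffun C -> bool}) :
    {ffun C -> option (mletter N)} :=
  [ffun c => if c \in E then Tg.1 c else if c \in D then Some (kk, Tg.2 c) else None].

Definition unglue T : {ffun C -> option (mletter N)} * {ffun C -> bool} :=
  ([ffun c => if c \in E then T c else None],
   [ffun c => if c \in D :\: E then (if T c is Some a then a.2 else false) else false]).

Lemma unglueK T : filling_ok k.+1 D T -> small_cells k T = E -> glue (unglue T) = T.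
Proof.
move=> /filling_okP[h1 _ h3] eE; apply/ffunP => c; rewrite !ffunE /= ?ffunE inE.
case: (boolP (c \in E)) => //= cE; have := h1 c.
case: (c \in D); case e: (T c) => [a|] //= _.
have := h3 _ _ e; move: cE; rewrite -eE inE e /cell_ok => ak /andP[_ ak'].
by case: a ak ak' {e} => a1 a2 /= ak ak'; congr (Some (_, _)); apply/val_inj => /=; lia.
Qed.

Lemma glue_ok Tg :
  [&& filling_ok k.+1 D (glue Tg), small_cells k (glue Tg) == E & unglue (glue Tg) == Tg] =
  [&& E \subset D, compatible D E, filling_ok k E Tg.1 &
      Tg.2 \in pfamily false (mem (D :\: E)) (fun c => mark_ok (D :\: E) c)].
Proof.
case: Tg => T' g; set T := glue _ => /=.
have TE c : c \in E -> T c = T' c by move=> cE; rewrite ffunE cE.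
have TS c : c \in D :\: E -> T c = Some (kk, g c).
  by rewrite inE ffunE => /andP[/negbTE-> ->].
apply/and3P/and4P => [[/filling_okP[h1 h2 h3] /eqP eE /eqP eT]|].
  have [e1 e2] : (unglue T).1 = T' /\ (unglue T).2 = g by rewrite eT.
  have inE' c : c \in E -> exists2 a, T c = Some a & (a.1 < k)%N.
    by rewrite -eE inE; case: (T c) => [a|] // ak; exists a.
  have T'E c : T' c = if c \in E then T c else None by rewrite -e1 ffunE.
  split.
  - by apply/subsetP => c /inE'[a e _]; rewrite -h1 e.
  - apply/forall_inP => c cS; apply/forall_inP => c' /inE'[a e ak].
    have /and4P[l1 l2 _ _] := h2 _ _ _ _ (TS _ cS) e.
    have nle : (mrank (kk, g c) <= mrank a)%N = false.
      by rewrite /mrank /=; case: (a.2); case: (g c) => /=; lia.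
    by move: l1 l2; rewrite nle !implybF => -> ->.
  - apply/filling_okP; split=> [c|c1 c2 a1 a2|c a]; rewrite ?T'E.
    + by case: ifP => // /inE'[a -> _].
    + by do 2 case: ifP => // _; apply: h2.
    + case: ifP => // /inE'[a' e ak]; rewrite e => -[<-].
      by have := h3 _ _ e; rewrite /cell_ok ak => /andP[-> _].
  - apply/pfamilyP; split=> [|c cS].
      apply/subsetP => c; rewrite !inE -e2 ffunE inE.
      by case: ifP => //; rewrite eqxx.
    rewrite unfold_in /mark_ok; apply/and3P; split; apply/implyP => gc.
    + apply/forall_inP => c' cS'; apply/negP => l.
      have /and4P[l1 _ l2 _] := h2 _ _ _ _ (TS _ cS') (TS _ cS).
      have ne : pos c' != pos c.
        by apply: contraTneq l => ->; rewrite /left_of ltnn andbF.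
      move: l1 l2; rewrite l /= ne gc /mrank /= xpair_eqE eqxx /=.
      by case/andP: l => -> _; case: (g c') => //=; lia.
    + apply/forall_inP => c' cS'; apply/negP => l.
      have /and4P[_ l1 _ l2] := h2 _ _ _ _ (TS _ cS) (TS _ cS').
      have ne : pos c != pos c'.
        by apply: contraTneq l => ->; rewrite /above ltnn andbF.
      move: l1 l2; rewrite l /= ne (negbTE gc) /mrank /= xpair_eqE eqxx /=.
      by case/andP: l => -> _; case: (g c') => //=; lia.
    + by have := h3 _ _ (TS _ cS); rewrite /cell_ok gc /= implybF => /andP[].
case=> /subsetP sED /forall_inP cmp /filling_okP[h1 h2 h3] /pfamilyP[/subsetP sg mg].
have {}cmp c c' : c \in D :\: E -> c' \in E ->
    ~~ left_of (pos c) (pos c') && ~~ above (pos c) (pos c').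
  by move=> cS; move: c'; apply/forall_inP; apply: cmp.
have {}mg c : c \in D :\: E -> mark_ok (D :\: E) c (g c) by move=> cS; apply: mg.
have TN c a : T c = Some a ->
    (c \in E /\ T' c = Some a) \/ (c \in D :\: E /\ a = (kk, g c)).
  by rewrite ffunE inE; case: ifP => [cE e|_]; [left | case: ifP => // _ [<-]; right].
split.
- apply/filling_okP; split=> [c|c1 c2 a1 a2 /TN[[c1E e1]|[c1S ->]] /TN[[c2E e2]|[c2S ->]]|c a].
  + rewrite ffunE; case: ifP => [cE|_]; last by case: ifP.
    by rewrite h1 cE sED.
  + exact: h2 e1 e2.
  + have /andP[_ ak] := h3 _ _ e1.
    have nle : (mrank a1 <= mrank (kk, g c2))%N.
      by rewrite /mrank /=; case: (a1.2); case: (g c2) => /=; lia.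
    have ne : (a1 == (kk, g c2)) = false.
      by apply: contraTF ak => /eqP-> /=; rewrite ltnn.
    by rewrite /pair_ok nle ne !implybT !andbF.
  + have /andP[_ ak] := h3 _ _ e2.
    have ne : ((kk, g c1) == a2) = false.
      by apply: contraTF ak => /eqP<- /=; rewrite ltnn.
    have /andP[/negbTE l1 /negbTE l2] := cmp _ _ c1S c2E.
    by rewrite /pair_ok ne l1 l2 !andbF.
  + have /and3P[/implyP r1 /implyP b1 _] := mg _ c1S.
    have /and3P[/implyP r2 /implyP b2 _] := mg _ c2S.
    have R1 : left_of (pos c2) (pos c1) -> g c1 = false.
      by move=> l; apply/negbTE/negP => /r1/forall_inP/(_ _ c2S); rewrite l.
    have R2 : left_of (pos c1) (pos c2) -> g c2 = false.
      by move=> l; apply/negbTE/negP => /r2/forall_inP/(_ _ c1S); rewrite l.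
    have B1 : above (pos c1) (pos c2) -> g c1 = true.
      by move=> l; apply/negPn/negP => /b1/forall_inP/(_ _ c2S); rewrite l.
    have B2 : above (pos c2) (pos c1) -> g c2 = true.
      by move=> l; apply/negPn/negP => /b2/forall_inP/(_ _ c1S); rewrite l.
    rewrite /pair_ok /mrank /=; apply/and4P; split; apply/implyP.
    * by move/R2->; case: (g c1) => /=; lia.
    * by move/B1->; case: (g c2) => /=; lia.
    * case/andP=> /andP[er ne] /eqP[eg].
      have ne2 : (pos c1).2 != (pos c2).2.
        by apply: contraNneq ne => e; rewrite [pos c1]surjective_pairing
          [pos c2]surjective_pairing (eqP er) e.
      move: ne2; rewrite neq_ltn => /orP[lt|lt].
        by rewrite eg R2 // /left_of er.
      by rewrite R1 // /left_of eq_sym er.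
    * case/andP=> /andP[er ne] /eqP[eg].
      have ne2 : (pos c1).1 != (pos c2).1.
        by apply: contraNneq ne => e; rewrite [pos c1]surjective_pairing
          [pos c2]surjective_pairing (eqP er) e.
      move: ne2; rewrite neq_ltn => /orP[lt|lt].
        by rewrite B1 // /above er.
      by rewrite eg B2 // /above eq_sym er.
  + move=> /TN[[cE e]|[cS ->]].
      by have /andP[d ak] := h3 _ _ e; rewrite /cell_ok d ltnW.
    rewrite /cell_ok /= ltnSn andbT; have /and3P[_ _] := mg _ cS.
    by case: (g c) => //=; case: (_ == _).
- apply/eqP/setP => c; rewrite inE; case e: (T c) => [a|].
    case: (TN _ _ e) => [[cE e']|[cS ->]].
      by have /andP[_ ->] := h3 _ _ e'; rewrite cE.
    by rewrite /= ltnn; move: cS; rewrite inE => /andP[/negbTE->].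
  apply/esym/negbTE/negP => cE; have := h1 c.
  by rewrite -(TE _ cE) e cE.
apply/eqP; congr (_, _); apply/ffunP => c; rewrite ffunE.
  case: ifP => cE; first by rewrite TE.
  by have := h1 c; rewrite cE; case: (T' c).
case: ifP => [cS|cS]; first by rewrite TS.
by apply/esym/eqP; apply: contraFT cS => /(sg c).
Qed.
End Glue.

Lemma filling_sumS k D : (k < N)%N ->
  filling_sum k.+1 D = \sum_(E : {set C} | (E \subset D) && compatible D E)
    filling_sum k E * \prod_(c in D :\: E) \sum_(p | mark_ok (D :\: E) c p) x k.
Proof.
move=> kN; rewrite {1}/filling_sum.
rewrite (partition_big (small_cells k) predT) //= [RHS]big_mkcond.
apply: eq_bigr => E _.
rewrite (reindex_onto (glue kN D E) (unglue D E)); last first.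
  by move=> T /andP[h /eqP e]; apply: unglueK.
under eq_bigl => Tg do rewrite -andbA glue_ok.
case: ifP => [/andP[-> ->]|nh]; last first.
  by rewrite big_pred0 // => Tg; rewrite andbA nh.
rewrite (big_distr_big_dep false) /= big_distrlr /= pair_big /=.
apply: eq_big => [[T' g]|[T' g]] /=; first by [].
move=> /andP[/filling_okP[h1 _ _] _].
rewrite [X in _ = _ * X]big_mkcond -big_split; apply: eq_bigr => c _ /=.
rewrite ffunE inE /=; have := h1 c; case: ifP => cE /=; first by rewrite mulr1.
by case: (T' c) => // _; rewrite mul1r; case: ifP.
Qed.

Lemma filling_sum0 D : filling_sum 0 D = (D == set0)%:R.
Proof.
case: eqP => [->|/eqP /set0Pn[c cD]].
  rewrite /filling_sum (bigD1 [ffun=> None]) /=.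
    rewrite big1 => [|c _]; last by rewrite ffunE.
    rewrite big1 ?addr0 // => T /andP[/filling_okP[h1 _ _] /eqP[]].
    by apply/ffunP => c; have := h1 c; rewrite ffunE inE; case: (T c).
  by apply/filling_okP; split=> [c|c1 c2 a1 a2|c a]; rewrite ffunE ?inE.
rewrite /filling_sum big1 // => T /filling_okP[h1 _ h3].
have := h1 c; rewrite cD; case e: (T c) => [a|] // _.
by have /andP[] := h3 _ _ e.
Qed.
End MarkedFillings.

(** * Row weights *)


Definition part (b : bitseq) (i : nat) : nat := nth 0%N (parts b) i.

Lemma in_shifted_part b i j : in_shifted (parts b) i j = (i <= j < i + part b i)%N.
Proof.
rewrite /in_shifted /part; case: ltnP => //= h; rewrite nth_default //; lia.
Qed.

Lemma part_cons c b i :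
  part (c :: b) i = if c then (if i is i'.+1 then part b i' else (size b).+1) else part b i.
Proof. by case: c; case: i. Qed.

Definition strict_fun (f : nat -> nat) := forall i, (0 < f i.+1)%N -> (f i.+1 < f i)%N.

Lemma part0_le b : (part b 0 <= size b)%N.
Proof. by elim: b => [|[] b IH] //; rewrite part_cons /= ltnW. Qed.

Lemma part_strict b : strict_fun (part b).
Proof.
elim: b => [|c b IH] i; first by rewrite /part nth_nil.
rewrite !part_cons; case: c; last exact: IH.
by case: i => [|i]; [move=> _; rewrite ltnS part0_le | apply: IH].
Qed.

Lemma strict_fun_leq f i j : strict_fun f -> (i <= j)%N -> (0 < f j)%N ->
  (j + f j <= i + f i)%N.
Proof.
move=> sf; elim: j => [|j IH]; first by rewrite leqn0 => /eqP->.
rewrite leq_eqVlt => /orP[/eqP-> //|ij] fj; have := sf _ fj.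
by have := IH ij; lia.
Qed.

Lemma part_big b i : (size b <= i)%N -> part b i = 0%N.
Proof.
move=> h; case: (posnP (part b i)) => // p.
have := strict_fun_leq (@part_strict b) (leq0n i) p; have := part0_le b; lia.
Qed.

Lemma part_inj b1 b2 : size b1 = size b2 -> part b1 =1 part b2 -> b1 = b2.
Proof.
elim: b1 b2 => [|c1 b1 IH] [|c2 b2] //= [e] h.
have h0 := h 0%N; rewrite !part_cons in h0.
have l1 := part0_le b1; have l2 := part0_le b2.
have ec : c1 = c2 by case: (c1) (c2) h0 => [] [] //=; lia.
rewrite ec in h *; congr (_ :: _); apply: IH => // i.
by case: (c2) h => h; [have := h i.+1 | have := h i]; rewrite !part_cons.
Qed.

Lemma part_surj n f : strict_fun f -> (f 0 <= n)%N ->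
  exists2 b, size b = n & part b =1 f.
Proof.
elim: n f => [|n IH] f sf f0.
  exists [::] => // i; rewrite /part nth_nil; elim: i => [|i]; first lia.
  by case: (posnP (f i.+1)) => // /sf; lia.
have [e|ne] := eqVneq (f 0%N) n.+1.
  have [||b sb hb] := IH (fun i => f i.+1); first by move=> i; apply: sf.
    by case: (posnP (f 1%N)) => [-> //|/sf]; lia.
  exists (true :: b) => [/=|i]; first by rewrite sb.
  by rewrite part_cons; case: i => [|i]; rewrite ?sb ?hb.
have [//||b sb hb] := IH f; first by lia.
exists (false :: b) => [/=|i]; first by rewrite sb.
by rewrite part_cons.
Qed.

Section RowWeights.
Variable R : comNzRingType.
Implicit Types x : R.

Definition row_weight x (l m l' : nat) : R :=
  if (l' <= m <= l)%N then x ^+ (l - m) * (if (0 < m < l)%N && (l' != m) then 2%:R else 1)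
  else 0.

Lemma row_weight_prod x (i l m l' m' : nat) :
  (m <= l)%N -> ((0 < l')%N -> (l' < l)%N) -> ((0 < m')%N -> (m' < m)%N) ->
  \prod_(i + m <= j < i + l)
     (x *+ (((j == i + m) && (i != j)) + ~~ (i.+1 + m' <= j < i.+1 + l'))%N)
  = row_weight x l m l'.
Proof.
move=> ml l'l m'm; rewrite /row_weight ml andbT.
have [->|lt_ml] := eqVneq m l.
  rewrite big_geq // subnn mul1r ltnn andbF /= ifT //; lia.
have {}lt_ml : (m < l)%N by lia.
have [l'm|ml'] := leqP l' m; last first.
  rewrite (bigD1_seq (i + l')%N) /=; last exact: iota_uniq.
    rewrite (_ : (_ + _)%N = 0%N) ?mulr0n ?mul0r //; lia.
  by rewrite mem_index_iota; lia.
rewrite big_ltn; last lia.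
rewrite (eq_big_nat _ _ (F2 := fun=> x)) => [|j hj]; last first.
  by rewrite (_ : (_ + _)%N = 1%N) //; lia.
rewrite prodr_const_nat (_ : (i + l - (i + m).+1 = (l - m).-1)%N); last lia.
rewrite -[(l - m)%N in RHS]prednK; last lia.
rewrite exprS mulrAC; congr (_ * _).
case: ifP => h; last by rewrite mulr1 (_ : (_ + _)%N = 1%N) //; lia.
by rewrite mulr_natr (_ : (_ + _)%N = 2%N) //; lia.
Qed.

Lemma prod_row_weight x b b' K : size b = size b' -> (size b < K)%N ->
  \prod_(i < K) row_weight x (part b i) (part b' i) (part b i.+1) = VP x false b b' /\
  \prod_(i < K) row_weight x (part (true :: b) i) (part b' i) (part (true :: b) i.+1)
   = VP x true b b'.
Proof.
elim: b b' K => [|c b IH] [|d b'] // [|K] //.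
  move=> _ _; split; rewrite /VP /=.
    by rewrite big1 // => i _; rewrite /part !nth_nil /row_weight /= mul1r.
  rewrite big_ord_recl big1 ?mulr1 => [|i _]; rewrite /part /row_weight /= ?nth_nil /=.
    by rewrite expr1 mulr1.
  by rewrite mul1r.
move=> [e] lt_K; have lt_K' : (size b < K)%N by [].
have l1 := part0_le b; have l2 := part0_le b'.
have [i0 i1] := IH _ _ e lt_K'; have [j0 j1] := IH _ _ e (ltnW lt_K).
have P0 b1 : part (false :: b1) =1 part b1 by move=> i; rewrite part_cons.
have PS b1 i : part (true :: b1) i.+1 = part b1 i by rewrite part_cons.
have PT b1 : part (true :: b1) 0 = (size b1).+1 by rewrite part_cons.
case: c {lt_K}; case: d; rewrite /VP /= -!/(VP _ _ _ _); split.
- rewrite mul1r -i0 big_ord_recl [X in X * _](_ : _ = 1) ?mul1r.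
    by apply: eq_bigr => i _; rewrite !PS.
  by rewrite !PT PS e /row_weight /=; rewrite ifT ?subnn ?mul1r ?ltnn ?andbF //; lia.
- rewrite -i1 big_ord_recl; congr (_ * _).
    rewrite !PT PS PT /row_weight e /= eqxx /= andbF mulr1 ifT; last lia.
    by rewrite (_ : (_ - _)%N = 1%N) //; lia.
- by rewrite mul1r -j1; apply: eq_bigr => i _; rewrite P0.
- rewrite mul0r big_ord_recl [X in X * _](_ : _ = 0) ?mul0r //.
  by rewrite !(PS, PT, P0) /row_weight /= ifF //; lia.
- rewrite mul0r big_ord_recl [X in X * _](_ : _ = 0) ?mul0r //.
  by rewrite !(PS, PT, P0) /row_weight /= ifF //; lia.
- rewrite -i0 big_ord_recl; congr (_ * _).
    rewrite !(PS, PT, P0) /row_weight /= ifT; last lia.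
    rewrite (_ : ((size b).+2 - _)%N = 1%N); last lia.
    by rewrite expr1 ifT; [exact: mulrC | lia].
- by rewrite mul1r -j0; apply: eq_bigr => i _; rewrite !P0.
rewrite -j1 2!big_ord_recl mulrA; congr (_ * _).
  rewrite !(PS, PT, P0) /row_weight /=.
  have [h|h] := leqP (part b 0) (part b' 0); last by rewrite mulr0.
  have a1 : (part b' 0 <= (size b).+1)%N by lia.
  have a2 : (part b' 0 <= (size b).+2)%N by lia.
  have t1 : (part b' 0 < (size b).+1)%N by lia.
  have t2 : (part b' 0 < (size b).+2)%N by lia.
  by rewrite a1 a2 t1 t2 /= mulrA -exprS -subSn.
Qed.
End RowWeights.

(** * Shifted shapes *)


Section Shapes.
Variables (R : comNzRingType) (N : nat) (C : finType) (pos : C -> nat * nat).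
Hypothesis pos_inj : injective pos.
Variable x : nat -> R.
Implicit Types (b : bitseq) (c : C).

Definition shape b : {set C} := [set c | in_shifted (parts b) (pos c).1 (pos c).2].

Definition covered b := forall i j, (i <= j < i + part b i)%N -> exists c, pos c = (i, j).

Definition contained b' b : bool := [forall i : 'I_(size b).+1, (part b' i <= part b i)%N].

Lemma containedP b' b : size b' = size b ->
  reflect (forall i, (part b' i <= part b i)%N) (contained b' b).
Proof.
move=> e; apply: (iffP forallP) => [h i|h i]; last exact: h.
have [lt|ge] := ltnP i (size b).+1; first exact: (h (Ordinal lt)).
by rewrite part_big // e ltnW.
Qed.

Lemma mem_shape b c :
  (c \in shape b) = ((pos c).1 <= (pos c).2 < (pos c).1 + part b (pos c).1)%N.
Proof. by rewrite inE in_shifted_part. Qed.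

Lemma contained_covered b' b : size b' = size b -> contained b' b -> covered b -> covered b'.
Proof. by move=> e /(containedP e) h cb i j hij; apply: cb; have := h i; lia. Qed.

Lemma contained_subset b' b : size b' = size b -> covered b' ->
  contained b' b = (shape b' \subset shape b).
Proof.
move=> e cb; apply/(containedP e)/subsetP => [h c|h i].
  by rewrite !mem_shape; have := h (pos c).1; lia.
case: (posnP (part b' i)) => [-> //|p].
have [|c ec] := cb i (i + (part b' i).-1)%N; first lia.
by have := h c; rewrite !mem_shape ec /=; lia.
Qed.

Lemma shape_inj b1 b2 : size b1 = size b2 -> covered b1 -> covered b2 ->
  shape b1 = shape b2 -> b1 = b2.
Proof.
move=> e c1 c2 es; apply: part_inj => // i; apply/eqP; rewrite eqn_leq.
apply/andP; split; apply: (containedP _ _) => //.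
  by rewrite contained_subset // es.
by rewrite contained_subset // es.
Qed.

Lemma shape_compatible b' b : contained b' b -> size b' = size b ->
  compatible pos (shape b) (shape b').
Proof.
move=> ct e; apply/forall_inP => c; rewrite inE !mem_shape => /andP[nb' hb].
apply/forall_inP => c'; rewrite mem_shape => hb'.
move: (pos c) (pos c') nb' hb hb' => [i j] [i' j'] /= nb' hb hb'.
rewrite /left_of /above /=; apply/andP; split; apply/negP => /andP[/eqP eij lt].
  by move: nb' hb hb'; rewrite eij; lia.
have := @strict_fun_leq (part b') i i' (@part_strict b') (ltnW lt); lia.
Qed.

Lemma compatible_shape b (E : {set C}) : covered b -> E \subset shape b ->
  compatible pos (shape b) E ->
  exists b', [/\ size b' = size b, contained b' b & E = shape b'].
Proof.
move=> cb /subsetP sE /forall_inP cmp.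
pose Ep i j := [exists c in E, pos c == (i, j)].
have EpP i j : reflect (exists2 c, c \in E & pos c = (i, j)) (Ep i j).
  apply: (iffP existsP) => [[c /andP[cE /eqP ec]]|[c cE ec]]; exists c => //.
  by rewrite cE ec eqxx.
have Eb i j : Ep i j -> (i <= j < i + part b i)%N.
  by move=> /EpP[c /sE]; rewrite mem_shape => h ec; rewrite ec in h.
have closed i j i' j' : Ep i' j' -> (i <= j < i + part b i)%N ->
    left_of (i, j) (i', j') || above (i, j) (i', j') -> Ep i j.
  move=> /EpP[c' cE' ec'] hij h; have [c ec] := cb _ _ hij; apply/EpP; exists c => //.
  apply/negPn/negP => nE.
  have cS : c \in shape b :\: E by rewrite inE nE mem_shape ec.
  have /forall_inP/(_ _ cE') := cmp _ cS.
  by rewrite -negb_or ec ec' h.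
have ex i : exists m, ~~ Ep i (i + m)%N.
  by exists (part b i); apply/negP => h; have := Eb _ _ h; lia.
pose f i := ex_minn (ex i).
have fP i m : Ep i (i + m)%N = (m < f i)%N.
  rewrite /f; case: ex_minnP => m0 n0 min0; apply/idP/idP => [em|lt].
    rewrite ltnNge; apply: contraNN n0 => le.
    have := Eb _ _ em; rewrite leq_eqVlt in le; case/orP: le => [/eqP -> //|lt hb].
    apply: (closed _ _ _ _ em); first lia.
    by rewrite /left_of /= eqxx /=; lia.
  case h: (Ep i (i + m)%N) => //; have := min0 m; rewrite h => /(_ isT); lia.
have sf : strict_fun f.
  move=> i p; rewrite -fP.
  have e1 : Ep i.+1 (i.+1 + (f i.+1).-1)%N by rewrite fP; lia.
  have eq : (i.+1 + (f i.+1).-1 = i + f i.+1)%N by lia.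
  rewrite eq in e1; apply: (closed _ _ _ _ e1).
    have := Eb _ _ e1; have := @strict_fun_leq _ i i.+1 (@part_strict b); lia.
  by rewrite /above /= eqxx ltnSn orbT.
have f0 : (f 0 <= size b)%N.
  case: (posnP (f 0%N)) => [-> //|p].
  have /Eb : Ep 0%N (0 + (f 0).-1)%N by rewrite fP; lia.
  by have := part0_le b; lia.
have [b' sb' hb'] := part_surj sf f0; exists b'; split=> //.
  apply/(containedP sb') => i; rewrite hb'; case: (posnP (f i)) => [-> //|p].
  have /Eb : Ep i (i + (f i).-1)%N by rewrite fP; lia.
  by lia.
apply/setP => c; rewrite mem_shape hb'.
have -> : (c \in E) = Ep (pos c).1 (pos c).2.
  apply/idP/EpP => [cE|[c' cE' ec']]; first by exists c => //; case: (pos c).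
  by rewrite (_ : c = c') //; apply: pos_inj; rewrite ec'; case: (pos c).
have [le|gt] := leqP (pos c).1 (pos c).2; last by apply/negbTE/negP => h; have := Eb _ _ h; lia.
by rewrite -{1}(subnKC le) fP; lia.
Qed.

Lemma shape_prod b b' (F : nat * nat -> R) : covered b -> size b' = size b ->
  \prod_(c in shape b :\: shape b') F (pos c) =
  \prod_(i < (size b).+1) \prod_(i + part b' i <= j < i + part b i) F (nat_of_ord i, j).
Proof.
move=> cb e.
pose r := [seq (i, j) | i <- iota 0 (size b).+1,
                        j <- index_iota (i + part b' i) (i + part b i)].
transitivity (\prod_(q <- r) F q); last first.
  rewrite big_allpairs_dep.
  rewrite -(big_mkord xpredT (fun i => \prod_(i + part b' i <= j < i + part b i) F (i, j))).
  by rewrite {2}/index_iota subn0.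
rewrite -big_enum /= -(big_map pos xpredT F); apply: perm_big; apply: uniq_perm.
- by rewrite map_inj_uniq // enum_uniq.
- apply: allpairs_uniq_dep; first exact: iota_uniq.
    by move=> i _; apply: iota_uniq.
  by move=> [i1 j1] [i2 j2] _ _ /= [-> ->].
move=> [i j]; apply/mapP/allpairsPdep => [[c]|[i' [j' [hi hj [-> ->]]]]].
  rewrite mem_enum inE !mem_shape => h ec; rewrite -ec /= in h.
  exists i, j; rewrite mem_iota mem_index_iota /= add0n; split=> //; last lia.
  by rewrite ltnNge; apply/negP => gt; move: h; rewrite (part_big (ltnW gt)); lia.
move: hi hj; rewrite mem_iota mem_index_iota /= add0n => hi hj.
have [|c ec] := cb i' j'; first lia.
by exists c => //; rewrite mem_enum inE !mem_shape ec /=; lia.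
Qed.

Lemma mark_sum b b' c (y : R) : covered b -> size b' = size b -> contained b' b ->
  c \in shape b :\: shape b' ->
  \sum_(p | mark_ok pos (shape b :\: shape b') c p) y =
  y *+ ((((pos c).2 == (pos c).1 + part b' (pos c).1) && ((pos c).1 != (pos c).2)) +
     ~~ ((pos c).1.+1 + part b' (pos c).1.+1 <= (pos c).2
           < (pos c).1.+1 + part b (pos c).1.+1))%N.
Proof.
move=> cb e ct cS; set S := _ :\: _ in cS *.
have ctP := containedP e ct.
have memS c0 : (c0 \in S) =
    ((pos c0).1 + part b' (pos c0).1 <= (pos c0).2 < (pos c0).1 + part b (pos c0).1)%N.
  by rewrite inE !mem_shape; have := ctP (pos c0).1; lia.
have hc := cS; rewrite memS in hc; case ep: (pos c) hc => [i j] /= hc.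
have mt : mark_ok pos S c true = (j == i + part b' i)%N && (i != j).
  rewrite /mark_ok /= ep /=; case: (i != j); rewrite ?andbF ?andbT //.
  apply/forall_inP/eqP => [h|ej c' c'S].
    have [|c' ec'] := cb i (i + part b' i)%N; first by lia.
    have := h c'; rewrite memS ec' /left_of /= eqxx /=; have := ctP i; lia.
  apply/negP => /andP[/= /eqP er lt]; move: c'S; rewrite memS er; lia.
have mf : mark_ok pos S c false = ~~ (i.+1 + part b' i.+1 <= j < i.+1 + part b i.+1)%N.
  rewrite /mark_ok /= andbT ep; apply/forall_inP/negP => [h hj|h c' c'S].
    have [|c' ec'] := cb i.+1 j; first by lia.
    by have := h c'; rewrite memS ec' /= hj /above /= eqxx ltnSn => /(_ isT).
  apply/negP => /andP[/= /eqP er lt]; apply: h; move: c'S; rewrite memS -er.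
  move: (pos c').1 lt => i' lt hi'.
  have := @strict_fun_leq _ _ _ (@part_strict b) lt.
  have := @part_strict b' i; lia.
rewrite (bigID id) /= mulrnDr; congr (_ + _).
  rewrite -mt; case hm: (mark_ok pos S c true).
    rewrite (eq_bigl (pred1 true)) ?big_pred1_eq // => -[]; rewrite ?hm ?andbF //.
  by rewrite big_pred0 // => -[]; rewrite ?hm ?andbF.
rewrite -mf; case hm: (mark_ok pos S c false).
  rewrite (eq_bigl (pred1 false)) ?big_pred1_eq // => -[]; rewrite ?hm ?andbF //.
by rewrite big_pred0 // => -[]; rewrite ?hm ?andbF.
Qed.

Lemma strip_weight b b' (y : R) : covered b -> size b' = size b -> contained b' b ->
  \prod_(c in shape b :\: shape b') \sum_(p | mark_ok pos (shape b :\: shape b') c p) y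
  = VP y false b b'.
Proof.
move=> cb e ct; have [<- _] := prod_row_weight y (esym e) (ltnSn (size b)).
rewrite (eq_bigr _ (fun c cS => mark_sum y cb e ct cS)).
rewrite (@shape_prod b b' (fun q => y *+ (((q.2 == q.1 + part b' q.1) && (q.1 != q.2)) +
     ~~ (q.1.+1 + part b' q.1.+1 <= q.2 < q.1.+1 + part b q.1.+1))%N)) //=.
apply: eq_bigr => i _; apply: row_weight_prod; try exact: part_strict.
exact: (containedP e ct).
Qed.

Lemma VP_not_contained b b' (y : R) : size b' = size b -> ~~ contained b' b ->
  VP y false b b' = 0.
Proof.
move=> e; have [<- _] := prod_row_weight y (esym e) (ltnSn (size b)).
rewrite negb_forall => /existsP[i lt]; rewrite (bigD1 i) //= /row_weight ifF ?mul0r //.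
by rewrite (negbTE lt) andbF.
Qed.

Lemma filling_sum_Pvec k b : (k <= N)%N -> covered b ->
  filling_sum N pos x k (shape b) = Pvec x k b.
Proof.
elim: k b => [|k IH] b kN cb.
  have part0 i : part (nobits (size b)) i = 0%N by rewrite /part parts_nobits nth_nil.
  have sh0 : shape (nobits (size b)) = set0.
    by apply/setP => c; rewrite mem_shape part0 inE; lia.
  rewrite filling_sum0 -sh0 /=; congr (nat_of_bool _)%:R; apply/eqP/eqP => [|<- //].
  apply: shape_inj; rewrite ?size_nobits //.
  by move=> i j; rewrite part0; lia.
rewrite filling_sumS //= (bigID (contained ^~ b)) /= [X in _ = _ + X]big1_seq ?addr0; last first.
  move=> b'; rewrite mem_bits => /andP[nc /eqP e].
  by rewrite VP_not_contained ?mul0r.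
pose r := [seq b' <- bits (size b) | contained b' b].
have rP b' : b' \in r -> [/\ size b' = size b, contained b' b & covered b'].
  rewrite mem_filter mem_bits => /andP[ct /eqP e]; split=> //.
  exact: contained_covered cb.
transitivity (\sum_(b' <- r) filling_sum N pos x k (shape b') *
   \prod_(c in shape b :\: shape b')
      \sum_(p | mark_ok pos (shape b :\: shape b') c p) x k); last first.
  rewrite -big_filter; apply: eq_big_seq => b' /rP[e ct cv].
  by rewrite strip_weight // IH // 1?mulrC // ltnW.
rewrite -(big_map shape xpredT (fun E => filling_sum N pos x k E *
   \prod_(c in shape b :\: E) \sum_(p | mark_ok pos (shape b :\: E) c p) x k)).
rewrite [RHS]big_uniq; last first.
  rewrite map_inj_in_uniq ?filter_uniq ?bits_uniq // => b1 b2 /rP[e1 _ c1] /rP[e2 _ c2].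
  by apply: shape_inj; rewrite // e1 e2.
apply: eq_bigl => E; apply/andP/mapP => [[sE cE]|[b' /rP[e ct cv] ->]].
  have [b' [e ct eE]] := compatible_shape cb sE cE; exists b' => //.
  by rewrite mem_filter mem_bits e eqxx ct.
by rewrite -contained_subset // shape_compatible.
Qed.
End Shapes.

Section SchurP.
Variables (R : comNzRingType) (N : nat) (x : nat -> R).

Definition schurP_sum (la : seq nat) : R :=
  \sum_(T : {ffun cellbox la -> option (mletter N)} | is_mst T)
    \prod_(c : cellbox la) letter_weight x (T c).

Definition cell_pos (la : seq nat) (c : cellbox la) : nat * nat := (val c.1, val c.2).

Lemma cell_pos_inj la : injective (@cell_pos la).
Proof. by move=> [i j] [i' j'] [/val_inj -> /val_inj ->]. Qed.

Lemma is_mstE la (T : {ffun cellbox la -> option (mletter N)}) :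
  is_mst T = filling_ok (@cell_pos la) N [set c | is_cell c] T.
Proof.
rewrite /is_mst /filling_ok -andbA; congr [&& _, _ & _].
- by apply: eq_forallb => c; rewrite inE.
- apply: eq_forallb => c; case: (T c) => [a|]; last by rewrite implybT.
  by rewrite /cell_ok ltn_ord andbT.
Qed.

Lemma nth_le_sumn s i : (nth 0 s i <= sumn s)%N.
Proof. by elim: s i => [|a s IH] [|i] //=; [lia | have := IH i; lia]. Qed.

Lemma schurP_sum_Pvec b : schurP_sum (parts b) = Pvec x N b.
Proof.
rewrite -(filling_sum_Pvec (@cell_pos_inj (parts b)) x (leqnn N)).
  by apply: eq_bigl => T; rewrite is_mstE.
move=> i j; rewrite -in_shifted_part => /andP[hi hj].
have lt_j : (j < size (parts b) + sumn (parts b))%N.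
  by have := nth_le_sumn (parts b) i; lia.
by exists (Ordinal hi, Ordinal lt_j).
Qed.
End SchurP.

(** * Comparison of the two series *)


Lemma mem_parts b p :
  (p \in parts b) = (0 < p <= size b)%N && nth false b (size b - p).
Proof.
elim: b => [|c b IH]; first by rewrite in_nil; case: p.
rewrite /= mem_cat IH; have [->|ne] := eqVneq p (size b).+1.
  by rewrite subnn ltnn /= orbF leqnn; case: c; rewrite ?inE ?eqxx.
have -> : (p \in (if c then [:: (size b).+1] else [::])) = false.
  by case: c; rewrite ?inE ?(negbTE ne).
have [le|gt] := leqP p (size b); first by rewrite subSn //= (leqW le).
by rewrite andbF /= (_ : (p <= (size b).+1)%N = false) ?andbF //; lia.
Qed.

Lemma gtn_transitive : transitive gtn.
Proof. by move=> p q r /= h1 h2; apply: ltn_trans h2 h1. Qed.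

Lemma parts_sorted b : sorted gtn (parts b).
Proof.
elim: b => [|[] b IH] //=; rewrite path_sortedE; last exact: gtn_transitive.
rewrite IH andbT; apply/allP => p; rewrite mem_parts => /andP[/andP[_ h] _].
by rewrite /= ltnS.
Qed.

Section StrictPartitionSets.
Variable n : nat.
Implicit Types (A : {set 'I_n.+1}) (b : bitseq).

Definition set_of_bits b : {set 'I_n.+1} := [set i | val i \in parts b].

Lemma part_of_set_bits b : size b = n -> part_of_set (set_of_bits b) = parts b.
Proof.
move=> sb; apply: (@sorted_eq _ geq).
- by move=> p q r /= h1 h2; apply: leq_trans h2 h1.
- by move=> p q /=; rewrite -eqn_leq eq_sym => /eqP.
- by apply: sort_sorted => p q /=; apply: leq_total.
- by apply: sub_sorted (parts_sorted b) => p q /=; apply: ltnW.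
rewrite (perm_trans (permEl (perm_sort _ _))) //; apply: uniq_perm.
- by rewrite map_inj_uniq ?enum_uniq //; apply: val_inj.
- by apply: sorted_uniq (parts_sorted b); [apply: gtn_transitive | move=> p; rewrite /= ltnn].
move=> p; apply/mapP/idP => [[i]|hp]; first by rewrite mem_enum inE => h ->.
have lt : (p < n.+1)%N by move: hp; rewrite mem_parts sb; lia.
by exists (Ordinal lt); rewrite ?mem_enum ?inE.
Qed.

Lemma sumn_part_of_set A : sumn (part_of_set A) = (\sum_(i in A) val i)%N.
Proof.
rewrite (perm_sumn (permEl (perm_sort _ _))) sumnE big_map big_enum //.
Qed.

Lemma size_part_of_set A : size (part_of_set A) = #|A|.
Proof. by rewrite size_sort size_map -cardE. Qed.

Lemma set_of_bits_surj A : ord0 \notin A -> exists2 b, size b = n & A = set_of_bits b.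
Proof.
move=> A0; exists (mkseq (fun k => inord (n - k) \in A) n); first by rewrite size_mkseq.
apply/setP => i; rewrite inE mem_parts size_mkseq.
have [->|i0] := eqVneq i ord0; first by rewrite (negbTE A0).
have {}i0 : (0 < i)%N by rewrite lt0n.
have le : (i <= n)%N by rewrite -ltnS.
rewrite nth_mkseq; last by rewrite ltn_subrL i0 (leq_trans i0 le).
by rewrite subKn // inord_val i0 le.
Qed.

Lemma big_strict_partition_set (V : nmodType) (F : seq nat -> V) :
  \sum_(A : {set 'I_n.+1} | strict_partition_set A) F (part_of_set A) =
  \sum_(b <- bits n | sumn (parts b) == n) F (parts b).
Proof.
rewrite -[RHS]big_filter; set r := filter _ _.
have rP b : b \in r -> size b = n /\ sumn (parts b) = n.
  by rewrite mem_filter mem_bits => /andP[/eqP e1 /eqP e2].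
transitivity (\sum_(b <- r) F (part_of_set (set_of_bits b))); last first.
  by apply: eq_big_seq => b /rP[sb _]; rewrite part_of_set_bits.
rewrite -(big_map set_of_bits xpredT (fun A => F (part_of_set A))) [RHS]big_uniq; last first.
  rewrite map_inj_in_uniq ?filter_uniq ?bits_uniq // => b1 b2 /rP[s1 _] /rP[s2 _] e.
  apply: part_inj; first by rewrite s1 s2.
  by move=> i; rewrite /part -(part_of_set_bits s1) e part_of_set_bits.
apply: eq_bigl => A; apply/andP/mapP => [[A0 /eqP sA]|[b /rP[sb hb] ->]].
  have [b sb eA] := set_of_bits_surj A0; exists b => //.
  rewrite mem_filter mem_bits sb eqxx andbT -(part_of_set_bits sb) -eA.
  by rewrite sumn_part_of_set sA.
split; first by rewrite inE mem_parts.
by rewrite -sumn_part_of_set part_of_set_bits // hb.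
Qed.
End StrictPartitionSets.

Section Morphisms.
Variables (R S : comNzRingType) (f : {rmorphism R -> S}).

Lemma rmorph_VP (x : R) h l m : f (VP x h l m) = VP (f x) h l m.
Proof.
elim: l m h => [|c l IH] [|d m] h; rewrite /VP /=; try by case: h; rewrite ?rmorph1.
rewrite rmorphM -/(VP _ _ _ _) IH; congr (_ * _).
by case: h; case: c; case: d; rewrite /= ?rmorphM ?rmorph_nat ?rmorph0 ?rmorph1.
Qed.

Lemma rmorph_Pvec (x : nat -> R) N b : f (Pvec x N b) = Pvec (f \o x) N b.
Proof.
elim: N b => [|N IH] b /=; first exact: rmorph_nat.
by rewrite rmorph_sum; apply: eq_bigr => m _; rewrite rmorphM rmorph_VP IH.
Qed.
End Morphisms.

Definition ord_var (N k : nat) : {mpoly rat[N]} := oapp (fun i : 'I_N => 'X_i) 0 (insub k).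

Lemma ord_varE N (i : 'I_N) : ord_var N i = 'X_i.
Proof. by rewrite /ord_var valK. Qed.

Lemma SchurP_Pvec N b : SchurP N (parts b) = Pvec (ord_var N) N b.
Proof.
rewrite -schurP_sum_Pvec; apply: eq_bigr => T _; apply: eq_bigr => c _.
by case: (T c) => [a|] //=; rewrite ord_varE.
Qed.

Lemma meval1_SchurP N b : (SchurP N (parts b)).@[fun=> 1] = Pvec (fun=> 1) N b :> rat.
Proof.
rewrite -schurP_sum_Pvec rmorph_sum; apply: eq_bigr => T _.
rewrite rmorph_prod; apply: eq_bigr => c _.
by case: (T c) => [a|] /=; rewrite ?mevalXU ?rmorph1.
Qed.

Lemma cauchy_coefficient N M n (x : nat -> {mpoly rat[N]}) :
  (\sum_(l <- bits n) Qvec (fun i => 'X * (x i)%:P) N l * Pvec (fun=> (1 : {mpoly rat[N]})%:P) M l)`_n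
  = \sum_(l <- bits n | sumn (parts l) == n)
      ((2 ^ size (parts l))%:R * Pvec (fun=> 1) M l : rat) *: Pvec x N l.
Proof.
rewrite coef_sum [RHS]big_mkcond; apply: eq_bigr => l _.
rewrite Qvec_scale Qvec_Pvec -mulrA coefXnM.
have -> : Pvec (fun i => (x i)%:P) N l = (Pvec x N l)%:P.
  by rewrite [RHS]rmorph_Pvec.
have -> : Pvec (fun=> (1 : {mpoly rat[N]})%:P) M l = ((Pvec (fun=> 1) M l)%:MP_[N])%:P.
  rewrite !rmorph_Pvec.
  by congr (Pvec _ _ _).
rewrite -(rmorph_nat polyC 2) -rmorphXn -!rmorphM /= coefC.
case: ltngtP => h; rewrite ?subnn //=; first by rewrite subn_eq0 leqNgt h.
by rewrite h subnn eqxx -mul_mpolyC rmorphM /= natrX rmorphXn rmorph_nat mulrAC.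
Qed.

Lemma prod_pair_ord (V : comNzRingType) M N (F : 'I_N -> V) :
  \prod_(c <- index_enum ('I_M * 'I_N)%type) F c.2 = \prod_(j < M) \prod_(i < N) F i.
Proof. by rewrite pair_bigA. Qed.

Definition shifted_psum (n N : nat) : nat -> {mpoly rat[N]} :=
  odd_psum (index_enum ('I_n.+1 * 'I_N)%type) (fun c => 'X_(c.2)).

Lemma shifted_psumE n N k :
  shifted_psum n N k = n.+1%:R * (if odd k then 2%:R * psum N k else 0).
Proof.
rewrite /shifted_psum /odd_psum; case: odd; rewrite ?mulr0 // mulrCA; congr (_ * _).
transitivity (\sum_(j < n.+1) psum N k); first by rewrite pair_bigA.
by rewrite sumr_const card_ord mulr_natl.
Qed.

Lemma peval_shiftp_cycle n N (s : 'S_n) :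
  peval N (shiftp (p_cycle_type s)) =
  \prod_(c in porbits s) (if odd #|c| then 2%:R * psum N #|c| else 0).
Proof.
rewrite /p_cycle_type /shiftp /peval !rmorph_prod; apply: eq_bigr => c _ /=.
have lt : (#|c| < n.+1)%N by rewrite ltnS -[X in (_ <= X)%N]card_ord max_card.
rewrite comp_mpolyXU -tnth_nth tnth_mktuple inordK //; case: odd; last exact: rmorph0.
by rewrite rmorphM rmorph_nat /= comp_mpolyXU -tnth_nth tnth_mktuple inordK.
Qed.

Definition cycle_mean n N k : {mpoly rat[N]} :=
  (k`!%:R)^-1 *: cycle_sum (shifted_psum n N) k.

Lemma mulr_natl_scale N k (p : {mpoly rat[N]}) : k%:R * p = k%:R *: p.
Proof. by rewrite mulr_natl scaler_nat. Qed.

Lemma SH_cycle_mean n N : SH n N = (n.+1%:R)^-1 *: cycle_mean n N n.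
Proof.
rewrite /SH /PFp /shiftp /peval !comp_mpolyZ /cycle_mean [RHS]scalerA [_^-1 * _]mulrC -scalerA; congr (_ *: _).
rewrite [(\sum_s _) \mPo _]raddf_sum [(\sum_s _) \mPo _]raddf_sum /cycle_sum scaler_sumr.
apply: eq_bigr => s _ /=.
rewrite !comp_mpolyZ -/(shiftp _) -/(peval _ _) peval_shiftp_cycle.
rewrite /cycle_weight; under [in RHS]eq_bigr => c _ do rewrite shifted_psumE.
rewrite big_split /= prodr_const -natrX -pf_charE natrM -mulrA.
by rewrite mulr_natl_scale scalerA mulVf ?pnatr_eq0 // scale1r mulr_natl_scale.
Qed.

Lemma cycle_mean_coefficient n N :
  cycle_mean n N n = \sum_(l <- bits n | sumn (parts l) == n)
    ((2 ^ size (parts l))%:R * Pvec (fun=> 1) n.+1 l : rat) *: Pvec (ord_var N) N l.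
Proof.
have char0 k : k.+1%:R != 0 :> {mpoly rat[N]}.
  by rewrite -(rmorph_nat (@mpolyC N rat)) mpolyC_eq0 pnatr_eq0.
have factE k : cycle_sum (shifted_psum n N) k = k`!%:R * cycle_mean n N k.
  by rewrite /cycle_mean mulr_natl_scale scalerA mulfV ?scale1r // pnatr_eq0 -lt0n fact_gt0.
have rec k : k%:R * cycle_mean n N k =
    \sum_(j < k) shifted_psum n N j.+1 * cycle_mean n N (k - j.+1)%N.
  have nz : k`!%:R != 0 :> {mpoly rat[N]} by rewrite -(prednK (fact_gt0 k)) char0.
  by apply: (mulfI nz); apply: cycle_sum_recurrence.
have mean0 : cycle_mean n N 0 = 1.
  rewrite /cycle_mean /cycle_sum fact0 invr1 scale1r (big_pred1 1%g) => [|s].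
    rewrite /cycle_weight big_pred0 // => c; apply/imsetP => -[[]]; by [].
  by apply/esym/eqP/permP => -[].
have newton := @newton_generating_series _ n char0 _ _ _ _ mean0 rec.
have cauchy := @Cauchy _ n (ord_var N) (fun=> 1) N n.+1.
rewrite -cauchy_coefficient.
have -> : cycle_mean n N n = (\poly_(i < n.+1) cycle_mean n N i)`_n.
  by rewrite coef_poly ltnSn.
have prodE (e : {poly {mpoly rat[N]}} -> {poly {mpoly rat[N]}}) :
  \prod_(c <- index_enum ('I_n.+1 * 'I_N)%type) (1 + e ('X * ('X_(c.2))%:P)) =
  \prod_(j < n.+1) \prod_(i < N) (1 + e ('X * (ord_var N i)%:P * 1%:P)).
  rewrite (prod_pair_ord n.+1 (fun i => 1 + e ('X * ('X_i)%:P))).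
  by apply: eq_bigr => j _; apply: eq_bigr => i _; rewrite ord_varE mulr1.
apply: (@eqmodX_cancel _ n.+1 (\prod_(c <- index_enum ('I_n.+1 * 'I_N)%type)
   (1 - 'X * ('X_(c.2))%:P))) => //.
  rewrite -horner_coef0 horner_prod big1 // => c _.
  by rewrite !hornerE ?mul0r ?subr0.
apply: eqmodX_trans newton _.
rewrite (prodE id) (prodE -%R); exact: eqmodX_sym.
Qed.

Theorem theorem2p4 (n : nat) (hn : (1 <= n)%N) (N : nat) :
  SH n N =
  (n.+1%:R)^-1 *:
    \sum_(A : {set 'I_n.+1} | strict_partition_set A)
      ((2 ^ #|A|)%:R * (SchurP n.+1 (part_of_set A)).@[fun _ => 1])
        *: SchurP N (part_of_set A).
Proof.
rewrite SH_cycle_mean cycle_mean_coefficient; congr (_ *: _).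
under [RHS]eq_bigr => A _ do rewrite -size_part_of_set.
rewrite (@big_strict_partition_set n _ (fun la => ((2 ^ size la)%:R *
  (SchurP n.+1 la).@[fun _ => 1]) *: SchurP N la)).
by apply: eq_bigr => b _; rewrite meval1_SchurP SchurP_Pvec.
Qed.
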